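(* Let $X$ be a Banach space and let $\lambda$ be a Lévy measure on $X$ with $0<\lambda(X)<\infty$. Suppose that $\mu=\mathrm{ID}(m,\mathcal{R},\lambda)$, that $\mu(X)=1$, and that $\|\cdot\|_X<\infty$ $\mu$-a.s. Then, for any submultiplicative function $h$, we have $h(\|\cdot\|_X)\in L^1(X,\mu)$ if $h(\|\cdot\|_X)\in L^1(X,\lambda)$.
   Context: The characteristic function of a Borel probability measure $\mu$ on $X$ is $\hat\mu(\varrho)=\int_X\exp(i\varrho(u))\,d\mu(u)$ for $\varrho\in X^*$ (the topological dual). A Radon probability measure $\mu$ on $X$ is infinitely divisible (ID) if for each $n\in\mathbb{N}$ there is a Radon probability measure $\mu_{1/n}$ on $X$ with $\mu=(\mu_{1/n})^{*n}$ ($n$-fold convolution). Let $B_X$ be the open unit ball of $X$ and $\Psi(u,\varrho)=\exp(i\varrho(u))-1-i\varrho(u)\mathbf{1}_{B_X}(u)$. A positive $\sigma$-finite Radon measure $\lambda$ on $X$ is a Lévy measure iff (1) $\lambda(\{0\})=0$; (2) $\int_X|\Psi(u,\varrho)|\,d\lambda(u)<\infty$ for every $\varrho\in X^*$; (3) $\varrho\mapsto\exp\left(\int_X\Psi(u,\varrho)\,d\lambda(u)\right)$ is the characteristic function of a Radon probability measure on $X$. $\mu=\mathrm{ID}(m,\mathcal{R},\lambda)$ means that $\mu$ is the infinitely divisible Radon probability measure on $X$ with $$\hat\mu(\varrho)=\exp\left(i\varrho(m)-\tfrac12\varrho(\mathcal{R}(\varrho))+\int_X\Psi(u,\varrho)\,d\lambda(u)\right),\quad\varrho\in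 X^*,$$ where $m\in X$, $\mathcal{R}:X^*\to X$ is a (positive definite) covariance operator of a centered Gaussian measure $\mathcal{N}(0,\mathcal{R})$ on $X$, and $\lambda$ is a Lévy measure on $X$. A non-negative, non-decreasing, locally bounded function $h:\mathbb{R}\to\mathbb{R}_+=[0,\infty)$ is submultiplicative if there is a constant $C>0$ with $h(t+s)\le C\,h(t)h(s)$ for all $t,s\in\mathbb{R}$. *)

(* Defs.v *)
From HB Require Import structures.
From mathcomp Require Import all_boot all_order all_algebra.
From mathcomp Require Import all_classical all_reals all_analysis.
From mathcomp Require Import complex.

Set Implicit Arguments.
Unset Strict Implicit.
Unset Printing Implicit Defensive.

Import Order.TTheory GRing.Theory Num.Theory.
Import numFieldNormedType.Exports.

Local Open Scope classical_set_scope.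
Local Open Scope ring_scope.
Local Open Scope complex_scope.

Notation borel T := (g_sigma_algebraType (@open T)).

Record dual (R : realType) (X : normedModType R) := Dual {
  dual_fun :> {linear X -> R^o} ;
  dual_continuous : continuous dual_fun }.

Definition cexp (R : realType) (z : R[i]) : R[i] :=
  (expR (complex.Re z))%:C * (cos (complex.Im z) +i* sin (complex.Im z)).

Definition cintegral (R : realType) d (T : measurableType d)
    (mu : {measure set T -> \bar R}) (f : T -> R[i]) : R[i] :=
  Rintegral mu setT (fun x => complex.Re (f x))
  +i* Rintegral mu setT (fun x => complex.Im (f x)).

(* Inner regularity only: local finiteness is not required, since a Levy
   measure may have infinite mass on every neighbourhood of the origin. *)
Definition radon (R : realType) (X : completeNormedModType R)
    (mu : {measure set (borel X) -> \bar R}) : Prop :=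
  forall A : set (borel X), measurable A ->
    mu A = ereal_sup [set mu K | K in [set K : set X | compact K /\ K `<=` A]].

Definition charfun (R : realType) (X : completeNormedModType R)
    (mu : {measure set (borel X) -> \bar R}) (rho : dual X) : R[i] :=
  cintegral mu (fun u : borel X => cexp ('i%C * (rho u)%:C)).

(* On a non-separable X addition need not be measurable for the product of the
   Borel sigma-algebras, so the convolution is given by the iterated integral
   int nu (A - x) dmu(x) instead of as a pushforward of the product measure. *)
Definition convolution (R : realType) (X : completeNormedModType R)
    (mu nu : set (borel X) -> \bar R) (A : set (borel X)) : \bar R :=
  (\int[mu]_x nu [set y : borel X | A ((x : X) + (y : X))%R])%E.

Definition convolution_pow (R : realType) (X : completeNormedModType R)
    (n : nat) (nu : set (borel X) -> \bar R) : set (borel X) -> \bar R :=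
  iter n (convolution nu) (@dirac _ (borel X) (0 : X) R).

Definition infinitely_divisible (R : realType) (X : completeNormedModType R)
    (mu : probability (borel X) R) : Prop :=
  radon mu /\
  forall n : nat, (0 < n)%N ->
    exists nu : probability (borel X) R, radon nu /\
      forall A : set (borel X), measurable A -> mu A = convolution_pow n nu A.

Definition Psi (R : realType) (X : completeNormedModType R)
    (rho : dual X) (u : X) : R[i] :=
  cexp ('i%C * (rho u)%:C) - 1 - 'i%C * (rho u)%:C * (\1_(ball (0 : X) 1) u)%:C.

Definition levy_measure (R : realType) (X : completeNormedModType R)
    (lambda : {measure set (borel X) -> \bar R}) : Prop :=
  [/\ sigma_finite setT lambda /\ radon lambda,
      lambda [set (0 : X)] = 0%E,
      forall rho : dual X,
        (\int[lambda]_u (complex.Re `|Psi rho u|)%:E < +oo)%E &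
      exists nu : probability (borel X) R, radon nu /\
        forall rho : dual X, charfun nu rho = cexp (cintegral lambda (Psi rho))].

(* The library's [normal_prob] takes a standard deviation and is not the Dirac
   mass when it is 0, whereas a degenerate law counts as Gaussian here. *)
Definition centered_normal (R : realType) (s : R) :
    set (measurableTypeR R) -> \bar R :=
  if s == 0 then @dirac _ (measurableTypeR R) 0 R else normal_prob 0 s.

Definition centered_gaussian (R : realType) (X : completeNormedModType R)
    (gamma : probability (borel X) R) : Prop :=
  radon gamma /\
  forall rho : dual X, exists s : R, forall A : set (measurableTypeR R), measurable A ->
    gamma (rho @^-1` A) = centered_normal s A.

Definition gaussian_covariance_operator (R : realType)
    (X : completeNormedModType R) (Q : dual X -> X) : Prop :=
  exists gamma : probability (borel X) R, centered_gaussian gamma /\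
    forall rho rho' : dual X,
      (rho' (Q rho))%:E = covariance gamma (rho : borel X -> R) rho'.

(* mu = ID(m, Q, lambda) *)
Definition is_ID (R : realType) (X : completeNormedModType R)
    (mu : probability (borel X) R) (m : X) (Q : dual X -> X)
    (lambda : {measure set (borel X) -> \bar R}) : Prop :=
  [/\ infinitely_divisible mu, gaussian_covariance_operator Q,
      levy_measure lambda &
      forall rho : dual X,
        charfun mu rho =
        cexp ('i%C * (rho m)%:C - (2^-1 * rho (Q rho))%:C
              + cintegral lambda (Psi rho))].

Definition submultiplicative (R : realType) (h : R -> R) : Prop :=
  [/\ forall t, 0 <= h t,
      {homo h : s t / s <= t},
      forall t : R, bounded_near h (nbhs t) &
      exists C : R, 0 < C /\ forall t s, h (t + s) <= C * h t * h s].

(* Main.v *)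
From HB Require Import structures.
Require Import Defs.
From mathcomp Require Import all_boot all_order all_algebra.
From mathcomp Require Import all_classical all_reals all_analysis.
From mathcomp Require Import measurable_realfun complex zify ring lra.

Import Order.TTheory GRing.Theory Num.Theory.
Import numFieldNormedType.Exports.

Local Open Scope classical_set_scope.
Local Open Scope ring_scope.

Set Implicit Arguments.
Unset Strict Implicit.
Unset Printing Implicit Defensive.

(** Why the theorem holds.  Write k for the total mass of lambda.  The
    characteristic function of ID(m, Q, lambda) factors as that of a point mass,
    times that of the Gaussian measure gamma with covariance Q, times that of
    the compound Poisson law which sums a Poisson(k) number of independent jumps
    of law lambda / k; so mu should be the law of the sum of three independent
    vectors.  Submultiplicativity and monotonicity give
    E h(|x + y|) <= C E h(|x|) E h(|y|) for independent x and y, so each factor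
    may be treated alone.
    - Compound Poisson: n jumps contribute at most h(0) (C J)^n with
      J = (1/k) int h(|u|) dlambda, and the Poisson weights sum these to an
      exponential series ([integral_h_cpoisson]).
    - Gaussian: h grows at most exponentially, while by Fernique's argument
      Gaussian tails decay much faster.  Along the scale tau_(j+1) = (9/4) tau_j the tail
      is at most 4^-(4^j) and C h is at most K^(3^j), so the integral of h
      converges ([fernique]).

    On a non-separable space addition is not measurable for the product of the
    Borel sigma-algebras, and passing from characteristic functions to Borel
    measures takes a further argument.  The proof is therefore run on the image of mu under a
    finite family of functionals rho_i of norm at most 1, that is on laws on
    I -> R, where equality of the characteristic functions does imply equality
    of the laws ([charfun_unique]).  It bounds the mu-integral of
    h(max_i |rho_i x|) by a constant M that depends neither on the family nor on
    its size ([cylinder_bound]).  Finally mu is tight, and by the Hahn-Banach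
    theorem a finite family of functionals computes the norm up to 1 on a compact
    set ([compact_norming]); letting the compact set exhaust mu bounds the
    integral of h(|x|) ([integrable_of_cylinder_bound]).

    Uniqueness of characteristic functions is proved without Fourier inversion.
    Two laws with the same trigonometric integrals integrate alike every
    function in the class generated from trigonometric functions by products and
    bounded pointwise limits.  Iterating the polynomial 3 v^2 - 2 v^3, which
    pushes [0, 1/2[ to 0 and ]1/2, 1] to 1, puts indicators of superlevel sets
    in that class, and rescaling the cosine then yields all half-spaces. *)

(** * Bounded measurable functions *)

Section bounded_integration.
Context d (T : measurableType d) (R : realType) (P : probability T R).

Lemma bounded_integrable (f : T -> R) (M : R) :
  measurable_fun setT f -> (forall x, `|f x| <= M) ->
  P.-integrable setT (EFin \o f).
Proof.
move=> mf fM; apply: measurable_bounded_integrable => //.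
  by rewrite (le_lt_trans (probability_le1 P _))// ltry.
by exists M; split; [exact: num_real|move=> y My x _ /=; apply: le_trans (fM x) (ltW My)].
Qed.

Definition bmfun (F : T -> R) : Prop :=
  measurable_fun setT F /\ exists M : R, forall x, `|F x| <= M.

Lemma bmfun_integrable F : bmfun F -> P.-integrable setT (EFin \o F).
Proof. by move=> [mF [M FM]]; exact: bounded_integrable FM. Qed.

Lemma bmfunM F G : bmfun F -> bmfun G -> bmfun (fun x => F x * G x).
Proof.
move=> [mF [M FM]] [mG [N GN]]; split; first exact: measurable_funM.
by exists (M * N) => x; rewrite normrM ler_pM.
Qed.

Lemma bmfunD F G : bmfun F -> bmfun G -> bmfun (fun x => F x + G x).
Proof.
move=> [mF [M FM]] [mG [N GN]]; split; first exact: measurable_funD.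
by exists (M + N) => x; rewrite (le_trans (ler_normD _ _))// lerD.
Qed.

Lemma bmfun_cst r : bmfun (fun=> r).
Proof. by split => //; exists `|r|. Qed.

Lemma bmfunB F G : bmfun F -> bmfun G -> bmfun (fun x => F x - G x).
Proof.
move=> [mF [M FM]] [mG [N GN]]; split; first exact: measurable_funB.
by exists (M + N) => x; rewrite (le_trans (ler_normB _ _))// lerD.
Qed.

Lemma Rintegral1 : \int[P]_x (1 : R) = 1.
Proof. by rewrite Rintegral_cst// mul1r [X in fine X]probability_setT. Qed.

Lemma bmfun_cos f : measurable_fun setT f -> bmfun (fun x => cos (f x)).
Proof.
move=> mf; split; last by exists 1 => x; exact: cos_max.
apply: measurableT_comp => //.
by apply: continuous_measurable_fun; exact: continuous_cos.
Qed.

Lemma bmfun_sin f : measurable_fun setT f -> bmfun (fun x => sin (f x)).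
Proof.
move=> mf; split; last by exists 1 => x; exact: sin_max.
apply: measurableT_comp => //.
by apply: continuous_measurable_fun; exact: continuous_sin.
Qed.

Lemma bounded_cvg_Rintegral (f_ : nat -> T -> R) (f : T -> R) (M : R) :
  (forall n, measurable_fun setT (f_ n)) ->
  (forall n x, `|f_ n x| <= M) -> (forall x, f_ ^~ x @ \oo --> f x) ->
  \int[P]_x f_ n x @[n --> \oo] --> \int[P]_x f x.
Proof.
move=> mf fM cf.
have mlim : measurable_fun setT f.
  by apply: (measurable_fun_cvg mf) => x _; exact: cf.
have limM x : `|f x| <= M.
  apply: (@closed_cvg _ _ _ eventually_filter (f_ ^~ x) [set y | `|y| <= M]) => //.
  - rewrite (_ : mkset _ = Num.norm @^-1` [set y | y <= M])//.
    by apply: closed_comp => [? _|]; [exact: norm_continuous|exact: closed_le].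
  - by apply: nearW => n /=; exact: fM.
rewrite [X in _ --> X](_ : _ = fine (\int[P]_x (f x)%:E)%E)//.
apply: fine_cvg; rewrite fineK; last first.
  by apply: integrable_fin_num => //; exact: bounded_integrable limM.
have [] := @dominated_convergence _ T R P setT measurableT
    (fun n x => (f_ n x)%:E) (fun x => (f x)%:E) (cst M%:E) => //.
- by move=> n; exact/measurable_EFinP.
- exact/measurable_EFinP.
- apply: aeW => x _; apply/fine_cvgP; split; [exact: nearW|exact: cf].
- exact: (@bounded_integrable (cst M) `|M|).
- by apply: aeW => x n _; rewrite /= lee_fin.
Qed.

End bounded_integration.

Section level_sets.
Context d (T : measurableType d) (R : realType) (g : T -> R).
Hypothesis mg : measurable_fun setT g.

Lemma measurable_sublevel r : measurable [set x | g x <= r].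
Proof.
rewrite (_ : mkset _ = g @^-1` `]-oo, r]).
  by rewrite -[X in measurable X]setTI; exact: mg.
by apply/seteqP; split => x /=; rewrite in_itv.
Qed.

Lemma measurable_superlevel r : measurable [set x | r < g x].
Proof.
rewrite (_ : mkset _ = g @^-1` `]r, +oo[).
  by rewrite -[X in measurable X]setTI; exact: mg.
by apply/seteqP; split => x /=; rewrite in_itv/= andbT.
Qed.

End level_sets.

Lemma superlevel_indicE T (R : realType) (g : T -> R) r :
  (fun x => (r < g x)%R%:R) = \1_[set x | r < g x] :> (T -> R).
Proof.
apply/funext => x; rewrite indicE; congr (nat_of_bool _)%:R.
by apply/idP/idP => rx; [rewrite inE|rewrite inE in rx].
Qed.

(** * Laws on finitely many coordinates *)

(** The product sigma-algebra on I -> R is taken as the one generated by the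
    coordinate projections: measurability of a map into it is then checked
    coordinate by coordinate. *)
Definition coord_gen (R : realType) (I : finType) : set (set (I -> R)) :=
  [set A | exists i (B : set R), measurable B /\ A = (fun x => x i) @^-1` B].

Notation coords R I := (g_sigma_algebraType (@coord_gen R I)).

Definition lin (R : realType) (I : finType) (c x : I -> R) : R :=
  \sum_i c i * x i.

Section coords.
Variables (R : realType) (I : finType).

Lemma measurable_coord (i : I) :
  measurable_fun setT (fun x : coords R I => x i).
Proof.
move=> _ B mB; rewrite setTI; apply: sub_sigma_algebra.
by exists i, B.
Qed.

Lemma measurable_coords d (T : measurableType d) (f : T -> coords R I) :
  (forall i, measurable_fun setT (fun t => f t i)) -> measurable_fun setT f.
Proof.
move=> mf; apply: (@measurability _ _ T (coords R I) setT f (@coord_gen R I) erefl).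
move=> _ [_ [i [B [mB ->]]] <-].
by have := mf i measurableT B mB; rewrite setTI.
Qed.

Lemma measurable_lin d (T : measurableType d) (c : I -> R) (f : T -> coords R I) :
  measurable_fun setT f -> measurable_fun setT (fun t => lin c (f t)).
Proof.
move=> mf; apply: measurable_sum => i; apply: measurable_funM => //.
exact: (measurableT_comp (measurable_coord i) mf).
Qed.

Lemma linZ (a : R) (c x : I -> R) : lin (fun i => a * c i) x = a * lin c x.
Proof. by rewrite /lin mulr_sumr; apply: eq_bigr => i _; rewrite mulrA. Qed.

Lemma linDl (c1 c2 x : I -> R) :
  lin (fun i => c1 i + c2 i) x = lin c1 x + lin c2 x.
Proof. by rewrite /lin -big_split; apply: eq_bigr => i _; rewrite mulrDl. Qed.

Lemma linBl (c1 c2 x : I -> R) :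
  lin (fun i => c1 i - c2 i) x = lin c1 x - lin c2 x.
Proof. by rewrite /lin -sumrB; apply: eq_bigr => i _; rewrite mulrBl. Qed.

Lemma linDr (c x y : I -> R) : lin c (fun i => x i + y i) = lin c x + lin c y.
Proof. by rewrite /lin -big_split; apply: eq_bigr => i _; rewrite mulrDr. Qed.

Lemma lin0 (x : I -> R) : lin (fun=> 0) x = 0.
Proof. by rewrite /lin big1// => i _; rewrite mul0r. Qed.

Lemma lin_delta (i : I) (x : I -> R) : lin (fun j => (j == i)%:R) x = x i.
Proof.
rewrite /lin (bigD1 i)//= eqxx mul1r big1 ?addr0// => j /negbTE ->.
by rewrite mul0r.
Qed.

End coords.

(** * A law on coordinates is determined by its characteristic function *)

Section smoothstep.
Variable R : realType.
Implicit Type v : R.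

(** Cubic with fixed points 0, 1/2 and 1, of which 0 and 1 attract: its iterates
    tend to a step function while staying polynomials in v. *)
Definition smoothstep (v : R) : R := 3 * v ^+ 2 - 2 * v ^+ 3.

Lemma smoothstep01 v : 0 <= v <= 1 -> 0 <= smoothstep v <= 1.
Proof.
move=> /andP[v0 v1]; rewrite /smoothstep; apply/andP; split.
  have -> : 3 * v ^+ 2 - 2 * v ^+ 3 = v ^+ 2 * (3 - 2 * v) by ring.
  by apply: mulr_ge0; [exact: sqr_ge0|lra].
rewrite -subr_ge0.
have -> : 1 - (3 * v ^+ 2 - 2 * v ^+ 3) = (1 - v) ^+ 2 * (1 + 2 * v) by ring.
by apply: mulr_ge0; [exact: sqr_ge0|lra].
Qed.

Lemma iter_smoothstep01 n v : 0 <= v <= 1 -> 0 <= iter n smoothstep v <= 1.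
Proof. by move=> v01; elim: n => //= n; exact: smoothstep01. Qed.

Lemma smoothstepC v : smoothstep (1 - v) = 1 - smoothstep v.
Proof. by rewrite /smoothstep; ring. Qed.

Lemma iter_smoothstepC n v : iter n smoothstep (1 - v) = 1 - iter n smoothstep v.
Proof. by elim: n => //= n ->; exact: smoothstepC. Qed.

Lemma iter_smoothstep_half n : iter n smoothstep 2^-1 = 2^-1.
Proof. by elim: n => //= n ->; rewrite /smoothstep; field. Qed.

Lemma cvg_iter_smoothstep0 v : 0 <= v -> v < 2^-1 ->
  iter n smoothstep v @[n --> \oo] --> (0 : R).
Proof.
(* below 1/2 an iterate w is multiplied by 3 w - 2 w ^ 2 <= q < 1 *)
move=> v0 v2; set q := 3 * v - 2 * v ^+ 2.
have q0 : 0 <= q.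
  have -> : q = v * (3 - 2 * v) by rewrite /q; ring.
  by apply: mulr_ge0 => //; lra.
have q1 : q < 1.
  rewrite -subr_gt0; have -> : 1 - q = (1 - v) * (1 - 2 * v) by rewrite /q; ring.
  by apply: mulr_gt0; lra.
have bnd n : 0 <= iter n smoothstep v <= v /\ iter n smoothstep v <= v * q ^+ n.
  elim: n => [|n [/andP[w0 wv] IH]]; first by rewrite expr0 mulr1 lexx v0.
  rewrite iterS; set w := iter n smoothstep v in w0 wv IH *.
  have swE : smoothstep w = w * (3 * w - 2 * w ^+ 2) by rewrite /smoothstep; ring.
  have wq : 3 * w - 2 * w ^+ 2 <= q.
    rewrite -subr_ge0.
    have -> : q - (3 * w - 2 * w ^+ 2) = (v - w) * (3 - 2 * (v + w)).
      by rewrite /q; ring.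
    by apply: mulr_ge0; lra.
  have w2 : 0 <= 3 * w - 2 * w ^+ 2.
    have -> : 3 * w - 2 * w ^+ 2 = w * (3 - 2 * w) by ring.
    by apply: mulr_ge0 => //; lra.
  rewrite swE mulr_ge0//=; split.
    apply: le_trans wv; rewrite -[leRHS]mulr1 ler_wpM2l//.
    exact: le_trans wq (ltW q1).
  have -> : v * q ^+ n.+1 = v * q ^+ n * q by rewrite exprSr mulrA.
  exact: ler_pM.
apply: (@squeeze_cvgr _ _ _ _ (cst 0) (fun n => v * q ^+ n)).
- by apply: nearW => n; have [/andP[-> _] ->] := bnd n.
- exact: cvg_cst.
- rewrite -(mulr0 v); apply: cvgMl_tmp; apply: cvg_expr.
  by rewrite ger0_norm.
Qed.

Lemma cvg_iter_smoothstep1 v : 2^-1 < v -> v <= 1 ->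
  iter n smoothstep v @[n --> \oo] --> (1 : R).
Proof.
move=> v2 v1.
have /cvg_iter_smoothstep0 : 0 <= 1 - v by lra.
move=> /(_ _)/wrap[|h]; first lra.
have -> : (fun n => iter n smoothstep v) =
          (fun n => 1 - iter n smoothstep (1 - v)).
  by apply/funext => n; rewrite iter_smoothstepC subKr.
by rewrite -[X in _ --> X](subr0 1); apply: cvgB => //; exact: cvg_cst.
Qed.

(** The iterates converge to 1/2 at v = 1/2; the polynomial 2 x ^ 2 - x fixes 0
    and 1 and sends 1/2 to 0, so that the limit is exactly an indicator. *)
Lemma cvg_threshold v : 0 <= v <= 1 ->
  2 * (iter n smoothstep v) ^+ 2 - iter n smoothstep v @[n --> \oo] -->
  ((2^-1 < v)%R%:R : R).
Proof.
move=> /andP[v0 v1].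
have lims (l : R) : iter n smoothstep v @[n --> \oo] --> l ->
  2 * (iter n smoothstep v) ^+ 2 - iter n smoothstep v @[n --> \oo] -->
  2 * l ^+ 2 - l.
  move=> h; apply: cvgB => //; apply: cvgMl_tmp.
  by under eq_fun do rewrite expr2; rewrite expr2; exact: cvgM.
case: (ltrgtP v 2^-1) => [v2|v2|->].
- have := lims _ (cvg_iter_smoothstep0 v0 v2).
  by rewrite expr0n mulr0 subr0.
- have := lims _ (cvg_iter_smoothstep1 v2 v1).
  by rewrite expr1n mulr1; have -> : 2 - 1 = 1 :> R by ring.
- under eq_fun do rewrite iter_smoothstep_half.
  have -> : 2 * 2^-1 ^+ 2 - 2^-1 = 0 :> R by field.
  exact: cvg_cst.
Qed.

End smoothstep.

Section charfun_unique.
Variables (R : realType) (I : finType) (P Q : probability (coords R I) R).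
Hypothesis cosPQ : forall c : I -> R,
  \int[P]_x cos (lin c x) = \int[Q]_x cos (lin c x).
Hypothesis sinPQ : forall c : I -> R,
  \int[P]_x sin (lin c x) = \int[Q]_x sin (lin c x).

Let T := coords R I.

(** [test F]: P and Q agree against F times any cosine.  The phase a makes
    cosines and sines a single case. *)
Let test (F : T -> R) := bmfun F /\ forall c a,
  \int[P]_x (F x * cos (lin c x + a)) = \int[Q]_x (F x * cos (lin c x + a)).

(** Stability under products, needed to form polynomials, is immediate for
    multipliers of test functions. *)
Let mult (g : T -> R) := bmfun g /\ forall F, test F -> test (fun x => g x * F x).

Let bmfun_cos_lin c a : bmfun (fun x : T => cos (lin c x + a)).
Proof. by apply: bmfun_cos; apply: measurable_funD => //; exact: (measurable_lin c (@measurable_id _ T setT)). Qed.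

Let bmfun_cos_lin0 c : bmfun (fun x : T => cos (lin c x)).
Proof. by apply: bmfun_cos; exact: (measurable_lin c (@measurable_id _ T setT)). Qed.

Let bmfun_sin_lin0 c : bmfun (fun x : T => sin (lin c x)).
Proof. by apply: bmfun_sin; exact: (measurable_lin c (@measurable_id _ T setT)). Qed.

Hint Resolve bmfun_cos_lin bmfun_cos_lin0 bmfun_sin_lin0 : core.
Hint Extern 0 (bmfun (fun=> _)) => exact: bmfun_cst : core.

Let test1 : test (fun=> 1).
Proof.
split=> // c a.
have E (mu : probability T R) : \int[mu]_x (1 * cos (lin c x + a)) =
    cos a * (\int[mu]_x cos (lin c x)) - sin a * (\int[mu]_x sin (lin c x)).
  rewrite -!RintegralZl//; try by apply: bmfun_integrable.
  rewrite -RintegralB//; try by apply: bmfun_integrable; apply: bmfunM.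
  by apply: eq_Rintegral => x _; rewrite mul1r cosD; ring.
by rewrite !E cosPQ sinPQ.
Qed.

Let testD F G : test F -> test G -> test (fun x => F x + G x).
Proof.
move=> [bF tF] [bG tG]; split; first by apply: bmfunD.
move=> c a.
have E (mu : probability T R) : \int[mu]_x ((F x + G x) * cos (lin c x + a)) =
    \int[mu]_x (F x * cos (lin c x + a)) + \int[mu]_x (G x * cos (lin c x + a)).
  rewrite -RintegralD//; try by apply: bmfun_integrable; apply: bmfunM.
  by apply: eq_Rintegral => x _; rewrite mulrDl.
by rewrite !E tF tG.
Qed.

Let testZ r F : test F -> test (fun x => r * F x).
Proof.
move=> [bF tF]; split; first by apply: bmfunM.
move=> c a.
have E (mu : probability T R) : \int[mu]_x ((r * F x) * cos (lin c x + a)) =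
    r * \int[mu]_x (F x * cos (lin c x + a)).
  rewrite -RintegralZl//; try by apply: bmfun_integrable; apply: bmfunM.
  by apply: eq_Rintegral => x _; rewrite mulrA.
by rewrite !E tF.
Qed.

Let mult_cst r : mult (fun=> r).
Proof. by split=> // F; exact: testZ. Qed.

Let multD f g : mult f -> mult g -> mult (fun x => f x + g x).
Proof.
move=> [bf tf] [bg tg]; split=> [|F tF]; first by apply: bmfunD.
under eq_fun do rewrite mulrDl.
by apply: testD; [exact: tf|exact: tg].
Qed.

Let multM f g : mult f -> mult g -> mult (fun x => f x * g x).
Proof.
move=> [bf tf] [bg tg]; split=> [|F tF]; first by apply: bmfunM.
under eq_fun do rewrite -mulrA.
by apply: tf; exact: tg.
Qed.

(** By cos A cos B = (cos (A + B) + cos (A - B)) / 2. *)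
Let mult_cos c b : mult (fun x => cos (lin c x + b)).
Proof.
split=> // F [bF tF]; split=> [|c' a]; first by apply: bmfunM.
have E (mu : probability T R) :
    \int[mu]_x (cos (lin c x + b) * F x * cos (lin c' x + a)) =
    2^-1 * ((\int[mu]_x (F x * cos (lin (fun i => c' i + c i) x + (a + b)))) +
            (\int[mu]_x (F x * cos (lin (fun i => c' i - c i) x + (a - b))))).
  rewrite -RintegralD//; try by apply: bmfun_integrable; apply: bmfunM.
  rewrite -RintegralZl//; last first.
    by apply: bmfun_integrable; apply: bmfunD; apply: bmfunM.
  apply: eq_Rintegral => x _; rewrite linDl linBl.
  have -> : lin c' x + lin c x + (a + b) = (lin c' x + a) + (lin c x + b) by ring.
  have -> : lin c' x - lin c x + (a - b) = (lin c' x + a) - (lin c x + b) by ring.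
  set A := lin c' x + a; set B := lin c x + b.
  by rewrite cosD cosB; field.
by rewrite !E !tF.
Qed.

(** Bounded pointwise limits of multipliers are multipliers, by dominated
    convergence. *)
Let mult_lim (g_ : nat -> T -> R) (g : T -> R) (M : R) : (forall n, mult (g_ n)) ->
  (forall n x, `|g_ n x| <= M) -> (forall x, g_ ^~ x @ \oo --> g x) -> mult g.
Proof.
move=> mg gM cg.
have mlim : measurable_fun setT g.
  by apply: (@measurable_fun_cvg _ _ _ _ g_) => [n|x _]; [have [[]] := mg n|exact: cg].
have bg : bmfun g.
  split => //; exists M => x.
  apply: (@closed_cvg _ _ _ eventually_filter (g_ ^~ x) [set y | `|y| <= M]) => //.
  - rewrite (_ : mkset _ = Num.norm @^-1` [set y | y <= M])//.
    by apply: closed_comp => [? _|]; [exact: norm_continuous|exact: closed_le].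
  - by apply: nearW => n /=; exact: gM.
split=> // F tF; have [bF _] := tF; split=> [|c a]; first by apply: bmfunM.
have [mF [N FN]] := bF.
have E (mu : probability T R) :
    \int[mu]_x (g_ n x * F x * cos (lin c x + a)) @[n --> \oo] -->
    \int[mu]_x (g x * F x * cos (lin c x + a)).
  apply: (@bounded_cvg_Rintegral _ _ _ _ _ _ (M * N * 1)) => [n|n x|x].
  - have [bgn _] := mg n.
    by have [] := bmfunM (bmfunM bgn bF) (bmfun_cos_lin c a).
  - by rewrite !normrM !ler_pM// ?mulr_ge0//; exact: cos_max.
  - by do 2 apply: cvgMr_tmp; exact: cg.
apply: (cvg_unique _ (E P)) => //.
have -> : (fun n => \int[P]_x (g_ n x * F x * cos (lin c x + a))) =
          (fun n => \int[Q]_x (g_ n x * F x * cos (lin c x + a))).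
  by apply/funext => n; have [_ /(_ F tF)[_ ->]] := mg n.
exact: E.
Qed.

Let mult_iter_smoothstep n g : mult g -> mult (fun x => iter n (@smoothstep R) (g x)).
Proof.
move=> mg; elim: n => //= n IH; rewrite /smoothstep.
set w := (fun x => iter n (@smoothstep R) (g x)) in IH *.
have -> : (fun x => 3 * iter n (@smoothstep R) (g x) ^+ 2 - 2 * iter n (@smoothstep R) (g x) ^+ 3) =
  (fun x => 3 * (w x * w x) + (-2) * (w x * (w x * w x))).
  by apply/funext => x; rewrite /w; ring.
apply: multD; apply: multM; try exact: mult_cst.
  exact: multM.
by apply: multM => //; exact: multM.
Qed.

(** The affine map v sends [-1, 1] into [0, 1] and r to the threshold 1/2; the
    indicator is the limit of polynomials in v. *)
Let mult_gt g (r : R) : mult g -> (forall x, `|g x| <= 1) -> `|r| <= 1 ->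
  mult (fun x => (r < g x)%R%:R).
Proof.
move=> mg g1 r1; pose v x := 2^-1 + (g x - r) / 4.
have mv : mult v.
  apply: multD; first exact: mult_cst.
  apply: multM; last exact: mult_cst.
  by apply: multD => //; exact: mult_cst.
have v01 x : 0 <= v x <= 1.
  move: (g1 x) r1; rewrite !ler_norml /v => /andP[? ?] /andP[? ?].
  by apply/andP; split; lra.
have -> : (fun x => (r < g x)%R%:R) = (fun x => (2^-1 < v x)%R%:R) :> (T -> R).
  by apply/funext => x; congr (nat_of_bool _)%:R; rewrite /v; apply/idP/idP; lra.
apply: (@mult_lim (fun n x => 2 * (iter n (@smoothstep R) (v x)) ^+ 2 - iter n (@smoothstep R) (v x)) _ 3).
- move=> n; have miv := mult_iter_smoothstep n mv.
  set w := (fun x => iter n (@smoothstep R) (v x)) in miv.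
  have -> : (fun x => 2 * iter n (@smoothstep R) (v x) ^+ 2 - iter n (@smoothstep R) (v x)) =
      (fun x => 2 * (w x * w x) + (-1) * w x).
    by apply/funext => x; rewrite /w; ring.
  apply: multD; apply: multM; try exact: mult_cst; last exact: miv.
  exact: multM.
- move=> n x; have /andP[w0 w1] := iter_smoothstep01 n (v01 x).
  rewrite (le_trans (ler_normB _ _))// !ger0_norm// ?mulr_ge0 ?sqr_ge0//.
  have : iter n (@smoothstep R) (v x) ^+ 2 <= 1 by rewrite expr_le1.
  by move: w1; lra.
- by move=> x; exact: cvg_threshold.
Qed.

(** The slab |lin c x - b| < r is the limit of the sets
    cos (r / n) < cos ((lin c x - b) / n): for n large both arguments lie in
    [0, pi], where cos is decreasing. *)
Let mult_slab c b r : 0 < r -> mult (fun x => (`|lin c x - b| < r)%R%:R).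
Proof.
move=> r0.
apply: (@mult_lim (fun n x => (cos (r / n.+1%:R) < cos ((lin c x - b) / n.+1%:R))%R%:R) _ 1).
- move=> n; apply: mult_gt; last exact: cos_max; last by move=> x; exact: cos_max.
  have -> : (fun x => cos ((lin c x - b) / n.+1%:R)) =
      (fun x => cos (lin (fun i => n.+1%:R^-1 * c i) x + (- (b / n.+1%:R)))).
    by apply/funext => x; rewrite linZ mulrBl [in X in X - _]mulrC.
  exact: mult_cos.
- by move=> n x; case: (_ < _); rewrite ?normr0 ?normr1.
- move=> x; set y := lin c x - b.
  apply: cvg_near_cst.
  near=> n.
  have n0 : 0 < n.+1%:R :> R by rewrite ltr0n.
  have small (t : R) : 0 <= t -> t <= n.+1%:R -> t / n.+1%:R \in `[0, pi].
    move=> t0 tn; rewrite in_itv/= divr_ge0 ?ler0n//=.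
    rewrite ler_pdivrMr// (le_trans tn)// ler_peMl ?ler0n//.
    by rewrite (le_trans _ (pi_ge2 R))// ler1n.
  rewrite -(cos_norm (y / _)) normrM [`|_^-1|]ger0_norm ?invr_ge0 ?ler0n//.
  rewrite ltr_cos ?small ?(ltW r0)//.
  + by rewrite ltr_pM2r ?invr_gt0.
  + by rewrite (@le_trans _ _ n%:R) ?ler_nat//; near: n; exact: nbhs_infty_ger.
  + by rewrite (@le_trans _ _ n%:R) ?ler_nat//; near: n; exact: nbhs_infty_ger.
Unshelve. all: by end_near. Qed.

Let Bset (A : set T) := mult (\1_A).

(** Closed under complements and intersections because multipliers form an
    algebra, and under countable unions because they are stable by limits. *)
Let Bset_sigma : sigma_algebra setT Bset.
Proof.
have B0 : Bset set0.
  by rewrite /Bset indic0; exact: mult_cst.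
have BC A : Bset A -> Bset (setT `\` A).
  rewrite /Bset setTD => mA.
  have -> : \1_(~` A) = (fun x => 1 + (-1) * \1_A x) :> (T -> R).
    by apply/funext => x; rewrite !indicE in_setC; case: (x \in A) => /=; ring.
  by apply: multD; [exact: mult_cst|apply: multM => //; exact: mult_cst].
have BI A B : Bset A -> Bset B -> Bset (A `&` B).
  by rewrite /Bset indicI => mA mB; exact: multM.
split => // F mF.
pose G n := \bigcap_(k < n) (~` F k).
have mG n : Bset (G n).
  elim: n => [|n IH].
    rewrite /G bigcap_mkord big_ord0 -(setC0) -setTD; exact: BC.
  have -> : G n.+1 = G n `&` ~` F n by rewrite /G !bigcap_mkord big_ord_recr.
  by apply: BI => //; rewrite -setTD; exact: BC.
rewrite -(setCK (\bigcup_k F k)) -setTD; apply: BC.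
rewrite setC_bigcup.
apply: (@mult_lim (fun n => \1_(G n)) _ 1) => // [n x|x].
  by rewrite indicE; case: (_ \in _); rewrite ?normr1 ?normr0.
apply: cvg_near_cst.
have [xF|/existsNP[k /not_implyP[_ kx]]] := pselect ((\bigcap_k ~` F k) x).
  near=> n; rewrite !indicE !mem_set// => k _.
  exact: xF.
near=> n; rewrite !indicE !memNset//.
  by move=> /(_ k Logic.I).
move=> /(_ k)/=; apply: contra_not kx => /(_ _)/wrap[|//].
near: n; exact: nbhs_infty_gt.
Unshelve. all: by end_near. Qed.

(** A half-line is a countable union of bounded symmetric slabs. *)
Let Bset_lin c (B : set R) : measurable B ->
  Bset ((fun x : T => lin c x) @^-1` B).
Proof.
have [B0 BC BU] := Bset_sigma.
have oo b : Bset ((fun x : T => lin c x) @^-1` `]b, +oo[).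
  have -> : (fun x : T => lin c x) @^-1` `]b, +oo[ =
     \bigcup_n [set x | `|lin c x - (b + n.+1%:R)| < n.+1%:R].
    apply/seteqP; split=> [x /=|x [n _] /=]; rewrite in_itv/= andbT.
      move=> bx; exists (Num.truncn (lin c x - b)) => //=.
      have := truncnS_gt (lin c x - b).
      rewrite ltr_norml; set m := _.+1%:R => h; apply/andP; split; last by lra.
      by lra.
    by rewrite ltr_norml => /andP[]; lra.
  apply: BU => n; have := mult_slab c (b + n.+1%:R) (ltr0Sn R n).
  congr mult; apply/funext => x; rewrite indicE; congr (nat_of_bool _)%:R.
  by apply/idP/idP => h; [rewrite inE|rewrite inE in h].
move=> mB; have {}mB : (@RGenOInfty.G R).-sigma.-measurable B.
  by rewrite -RGenOInfty.measurableE.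
suff : image_set_system setT (fun x : T => lin c x) Bset B.
  by rewrite /image_set_system /= setTI.
apply: (smallest_sub _ _ mB).
  exact: sigma_algebra_image.
by move=> _ [b ->]; rewrite /image_set_system /= setTI.
Qed.

Lemma charfun_unique (A : set T) : measurable A -> P A = Q A.
Proof.
move=> mA.
have BA : Bset A.
  apply: (smallest_sub Bset_sigma _ mA) => _ [i [B [mB ->]]].
  rewrite (_ : (fun x : I -> R => x i) = lin (fun j => (j == i)%:R)).
    exact: Bset_lin.
  by apply/funext => x; rewrite lin_delta.
have [_ /(_ _ test1)[_ /(_ (fun=> 0) 0)]] := BA.
have E (mu : probability T R) :
    \int[mu]_x (\1_A x * 1 * cos (lin (fun=> 0) x + 0)) = fine (mu A).
  rewrite /Rintegral -[in RHS](setIT A) -integral_indic//; congr fine.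
  by apply: eq_integral => x _; rewrite lin0 addr0 cos0 !mulr1.
rewrite !E => h; rewrite -(fineK (fin_num_measure P A mA)) h fineK//.
exact: fin_num_measure.
Qed.

End charfun_unique.

(** * Normal laws *)

Lemma is_derive_mull (R : realType) (t x : R) : is_derive x (1 : R) ( *%R t) t.
Proof.
apply: (is_derive_eq (is_deriveZ t (is_derive_id x (1 : R)))).
by rewrite /GRing.scale/= mulr1.
Qed.

Definition symitv (R : realType) (n : nat) : set R := `[- n%:R, n%:R].

Lemma measurable_symitv (R : realType) n : measurable (@symitv R n).
Proof. exact: measurable_itv. Qed.

Lemma cvg_integral_symitv (R : realType) (N : {measure set (measurableTypeR R) -> \bar R})
    (f : R -> R) :
  N.-integrable setT (EFin \o f) ->
  (\int[N]_(x in @symitv R n) (f x)%:E)%E @[n --> \oo] -->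
  (\int[N]_x (f x)%:E)%E.
Proof.
move=> intf.
have mf : measurable_fun setT (EFin \o f) by case/integrableP : intf.
have [] := @dominated_convergence _ (measurableTypeR R) R N setT measurableT
  (fun n => (EFin \o f) \_ (@symitv R n)) (EFin \o f) (abse \o (EFin \o f)).
- move=> n.
  have h : measurable_fun (@symitv R n) (EFin \o f) by exact: measurable_funTS.
  exact: (proj1 (measurable_restrictT (EFin \o f) (@measurable_symitv R n)) h).
- by [].
- apply: aeW => x _; apply: cvg_near_cst; near=> n.
  rewrite patchE mem_set//= /symitv/= in_itv/= -ler_norml.
  near: n; exact: nbhs_infty_ger.
- exact: integrable_abse.
- apply: aeW => x n _; rewrite patchE; case: ifPn => //= _.
  by rewrite normr0 lee_fin.
- move=> _ _ h.
  by under eq_fun do rewrite integral_mkcond.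
Unshelve. all: by end_near. Qed.

Section normal_moments.
Variables (R : realType) (s : R).
Hypothesis s0 : s != 0.
Local Notation N := (normal_prob (0 : R) s).
Local Notation pdf := (normal_pdf (0 : R) s).
Local Notation leb := (@lebesgue_measure R).

(** On a segment the integrand is bounded, so that the Radon-Nikodym derivative
    of the normal law may be replaced by its density. *)
Lemma integral_normal_itv a b (f : R -> R) : continuous f ->
  (\int[N]_(x in `[a, b]) (f x)%:E =
   \int[leb]_(x in `[a, b]) (f x * pdf x)%:E)%E.
Proof.
move=> cf; set U := `[a, b]%classic.
have mU : measurable U by exact: measurable_itv.
have mf : measurable_fun setT f by exact: continuous_measurable_fun.
have [M [_ HM]] : bounded_set (f @` U).
  apply: compact_bounded; apply: continuous_compact; last exact: segment_compact.
  exact: continuous_subspaceT.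
have intf : N.-integrable U (EFin \o f).
  apply: measurable_bounded_integrable => //.
  - by rewrite (le_lt_trans (probability_le1 _ _))// ltry.
  - exact: measurable_funTS.
  - exists M; split; first exact: num_real.
    by move=> y My x Ux; apply: (HM y My); exists x.
have dom := normal_prob_dominates 0 s.
rewrite -(Radon_Nikodym_change_of_variables dom)//=.
apply: ae_eq_integral => //.
- apply: emeasurable_funM => //; last first.
    apply: (measurable_int leb).
    apply: (integrableS _ _ (@subsetT _ _)) => //=.
    exact: Radon_Nikodym_integrable.
  by apply/measurable_EFinP; exact: measurable_funTS.
- apply/measurable_EFinP; apply: measurable_funTS; apply: measurable_funM => //.
  exact: measurable_normal_pdf.
- under [X in ae_eq _ _ _ X]eq_fun do rewrite EFinM.
  apply: ae_eqe_mul2l => /=.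
  rewrite Radon_NikodymE//=.
  case: cid => /= h [h1 h2 h3].
  apply: integral_ae_eq => //=.
  + exact: integrableS h2.
  + by apply/measurable_EFinP/measurable_funTS; exact: measurable_normal_pdf.
  + by move=> E EU mE; rewrite -h3.
Qed.

Lemma is_derive_normal_pdf (x : R) :
  is_derive x 1 pdf (- (x / s ^+ 2) * pdf x).
Proof.
rewrite normal_pdfE// /normal_fun.
have -> : (fun x0 : R => normal_peak s * expR (- (x0 - 0) ^+ 2 / (s ^+ 2 *+ 2))) =
   (normal_peak s) \*: (expR \o (fun x : R => (- (s ^+ 2 *+ 2)^-1) * x ^+ 2)).
  apply/funext => y /=; congr (_ * expR _).
  by rewrite subr0 mulNr mulrC mulNr.
apply: is_derive_eq.
rewrite /GRing.scale/= !mulr1 subr0.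
rewrite (_ : - x ^+ 2 / (s ^+ 2 *+ 2) = - (s ^+ 2 *+ 2)^-1 * x ^+ 2); last first.
  by rewrite mulNr mulrC mulNr.
rewrite -mulr_natl.
set e := expR _.
by field.
Qed.

Lemma normal_pdfN (x : R) : pdf (- x) = pdf x.
Proof. by rewrite normal_pdfE// /normal_fun !subr0 sqrrN. Qed.

(** Stein's identity: x pdf = - s^2 pdf', so the integrand times the density is
    the derivative of - s^2 g pdf.  The moments and the characteristic function
    below come from this identity with a letting tend to infinity. *)
Lemma stein (a : R) (g g' : R -> R) : 0 < a ->
  (forall x, is_derive x (1 : R) g (g' x)) -> continuous g' ->
  (\int[N]_(x in `[(- a)%R, a%R]) (x * g x - s ^+ 2 * g' x)%:E =
   (- s ^+ 2 * (g a - g (- a)) * pdf a)%:E)%E.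
Proof.
move=> a0 dg cg'.
have cg : continuous g.
  by move=> x; apply/differentiable_continuous/derivable1_diffP; have [] := dg x.
have cf : continuous (fun x : R => x * g x - s ^+ 2 * g' x).
  move=> x; apply: cvgB; apply: cvgM => //; [exact: cg|exact: cvg_cst|exact: cg'].
rewrite integral_normal_itv//.
pose G x := - s ^+ 2 * (g x * pdf x).
have dG (x : R) : is_derive x 1 G ((x * g x - s ^+ 2 * g' x) * pdf x).
  have := is_derive_normal_pdf x => dp.
  have -> : G = (- s ^+ 2) \*: (g * pdf) by [].
  apply: is_derive_eq.
  rewrite /GRing.scale/=; by field.
have cG : continuous G.
  by move=> x; apply/differentiable_continuous/derivable1_diffP; have [] := dG x.
rewrite (@continuous_FTC2 _ _ G).
- by rewrite /G normal_pdfN -EFinB; congr EFin; ring.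
- by lra.
- apply: continuous_subspaceT => x; apply: cvgM; first exact: cf.
  exact: continuous_normal_pdf.
- split.
  + by move=> x _; have [] := dG x.
  + by apply: cvg_at_right_filter; exact: cG.
  + by apply: cvg_at_left_filter; exact: cG.
- by move=> x _; rewrite derive1E; have [_] := dG x.
Qed.

(** From exp(u) >= u one gets pdf n <= cst / n^2. *)
Lemma cvg_normal_pdf : n%:R * pdf n%:R @[n --> \oo] --> (0 : R).
Proof.
have s2 : 0 < s ^+ 2 by rewrite exprn_even_gt0.
have key (n : nat) : n%:R * pdf n%:R <= (normal_peak s * (2 * s ^+ 2)) * (n%:R)^-1.
  case: n => [|n]; first by rewrite mul0r invr0 mulr0.
  set x : R := n.+1%:R; have x0 : 0 < x by rewrite ltr0n.
  rewrite normal_pdfE// /normal_fun subr0.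
  have e0 : x ^+ 2 / (2 * s ^+ 2) <= expR (x ^+ 2 / (2 * s ^+ 2)).
    by rewrite (le_trans _ (expR_ge1Dx _))// lerDr.
  have -> : - x ^+ 2 / (s ^+ 2 *+ 2) = - (x ^+ 2 / (2 * s ^+ 2)).
    by rewrite mulNr mulr_natl.
  rewrite expRN mulrCA -mulrA ler_wpM2l ?normal_peak_ge0//.
  rewrite ler_pdivrMr ?expR_gt0// mulrAC ler_pdivlMr// -expr2 mulrC.
  by rewrite -ler_pdivrMr// mulr_gt0.
apply: (@squeeze_cvgr _ _ _ _ (cst 0)
  (fun n => (normal_peak s * (2 * s ^+ 2)) * (n%:R)^-1)).
- by apply: nearW => n; rewrite key mulr_ge0//= normal_pdf_ge0.
- exact: cvg_cst.
- rewrite -[X in _ --> X](mulr0 (normal_peak s * (2 * s ^+ 2))).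
  apply: cvgMl_tmp.
  apply: (proj2 (@gtr0_cvgV0 R nat \oo _ (fun n => n%:R) _)).
    by near=> n; rewrite ltr0n; near: n; exact: nbhs_infty_gt.
  exact: cvgr_idn.
Unshelve. all: by end_near. Qed.

Lemma normal_second_moment : (\int[N]_x (x ^+ 2)%:E = (s ^+ 2)%:E)%E.
Proof.
have ndF : nondecreasing_seq (@symitv R).
  move=> m n mn; apply/subsetPset; apply: subset_itv; rewrite bnd_simp.
    by rewrite lerN2 ler_nat.
  by rewrite ler_nat.
have UF : \bigcup_n @symitv R n = [set: R].
  apply/seteqP; split => // x _; exists (Num.truncn `|x|).+1 => //=.
  by rewrite /symitv/= in_itv/= -ler_norml ltW// truncnS_gt.
have c1 : (\int[N]_(x in @symitv R n) (x ^+ 2)%:E)%E @[n --> \oo] -->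
    (\int[N]_x (x ^+ 2)%:E)%E.
  rewrite -UF; apply: ge0_nondecreasing_set_cvg_integral => //.
  - by move=> i; exact: measurable_symitv.
  - by move=> i; apply/measurable_EFinP; apply: measurable_funTS; exact: exprn_measurable.
  - by move=> i x _; rewrite lee_fin sqr_ge0.
have c2 : (\int[N]_(x in @symitv R n) (s ^+ 2)%:E)%E @[n --> \oo] -->
    ((s ^+ 2)%:E)%E.
  rewrite [X in _ --> X](_ : _ = \int[N]_x (s ^+ 2)%:E)%E; last first.
    by rewrite integral_cst//= [X in (_ * X)%E]probability_setT mule1.
  rewrite -UF; apply: ge0_nondecreasing_set_cvg_integral => //.
    by move=> i; exact: measurable_symitv.
  by move=> i x _; rewrite lee_fin sqr_ge0.
apply: (cvg_unique _ c1) => //.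
have E (n : nat) : (0 < n)%N -> (\int[N]_(x in @symitv R n) (x ^+ 2)%:E =
    \int[N]_(x in @symitv R n) (s ^+ 2)%:E
    + (- s ^+ 2 * 2 * (n%:R * pdf n%:R))%:E)%E.
  move=> n0; have n0' : 0 < n%:R :> R by rewrite ltr0n.
  have -> : (- s ^+ 2 * 2 * (n%:R * pdf n%:R)) =
      - s ^+ 2 * (id n%:R - id (- n%:R : R)) * pdf n%:R by rewrite /=; ring.
  rewrite -(@stein n%:R id (cst 1))//; last exact: cst_continuous.
  rewrite -integralD_EFin//.
  - by apply: eq_integral => x _; congr EFin; rewrite /=; ring.
  - exact: measurable_symitv.
  - apply: (integrableS _ _ (@subsetT _ _)) => //; first exact: measurable_symitv.
    exact: (bmfun_integrable N (bmfun_cst _ (s ^+ 2))).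
  - apply: measurable_bounded_integrable => //.
    + exact: measurable_symitv.
    + rewrite (le_lt_trans (probability_le1 _ _))// ?ltry//.
      exact: measurable_symitv.
    + apply: measurable_funTS; apply: measurable_funB => //.
      * exact: measurable_funM.
      * exact: (measurable_cst (s ^+ 2 * 1)).
    + exists (n%:R * n%:R + s ^+ 2); split; first exact: num_real.
      move=> y hy x /=; rewrite /symitv/= in_itv/= -ler_norml => hx.
      apply: le_trans (ltW hy); rewrite mulr1 (le_trans (ler_normB _ _))//.
      by rewrite (ger0_norm (sqr_ge0 s)) lerD2r normrM ler_pM.
have -> : ((s ^+ 2)%:E = (s ^+ 2)%:E + 0%:E)%E by rewrite adde0.
have : ((\int[N]_(x in @symitv R n) (s ^+ 2)%:E) + (- s ^+ 2 * 2 * (n%:R * pdf n%:R))%:E)%E @[n --> \oo] --> ((s ^+ 2)%:E + 0%:E)%E.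
  apply: cvgeD => //; apply: cvg_EFin; first exact: nearW.
  rewrite -[X in _ --> X](mulr0 (- s ^+ 2 * 2)); apply: cvgMl_tmp.
  exact: cvg_normal_pdf.
apply: cvg_trans; apply: near_eq_cvg; near=> n.
by rewrite E//; near: n; exact: nbhs_infty_gt.
Unshelve. all: by end_near. Qed.

Lemma integrable_normal_sqr : N.-integrable setT (fun x : R => (x ^+ 2)%:E).
Proof.
apply/integrableP; split; first by apply/measurable_EFinP; exact: exprn_measurable.
under eq_integral do rewrite /= ger0_norm ?sqr_ge0//.
by rewrite normal_second_moment ltry.
Qed.

Lemma integrable_normal_id : N.-integrable setT (fun x : R => x%:E).
Proof.
have i2 : N.-integrable setT (fun x : R => 1%:E + (x ^+ 2)%:E)%E.
  apply: integrableD => //; last exact: integrable_normal_sqr.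
  exact: (bmfun_integrable N (bmfun_cst _ 1)).
apply: (le_integrable _ _ _ i2) => //.
  by apply/measurable_EFinP; exact: measurable_id.
move=> x _; rewrite /= lee_fin [leRHS]ger0_norm ?addr_ge0 ?sqr_ge0//.
rewrite -(real_normK (num_real x)); have := sqr_ge0 (`|x| - 1).
by rewrite sqrrB1; have := normr_ge0 x; nra.
Qed.

Variable a : R.

Let F (t : R) : R := \int[N]_x cos (t * x + a).

Let measurable_affine (t : R) : measurable_fun setT (fun x : R => t * x + a).
Proof. by apply: measurable_funD => //; exact: measurable_funM. Qed.

Let integrable_trig (t : R) :
  N.-integrable setT (fun x => (x * sin (t * x + a))%:E) /\
  N.-integrable setT (fun x => (cos (t * x + a))%:E).
Proof.
split; last exact: (bmfun_integrable N (bmfun_cos (measurable_affine t))).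
apply: (le_integrable _ _ _ integrable_normal_id) => //.
- apply/measurable_EFinP; apply: measurable_funM => //.
  by have [] := bmfun_sin (measurable_affine t).
- move=> x _; rewrite /= lee_fin normrM ler_piMr//; exact: sin_max.
Qed.

Let is_derive_affine (t x : R) : is_derive x (1 : R) (fun x => t * x + a) t.
Proof.
apply: (is_derive_eq (is_deriveD (is_derive_mull t x) (is_derive_cst a x (1 : R)))).
exact: addr0.
Qed.

Let is_derive_sinM (t x : R) :
  is_derive x 1 (fun x => sin (t * x + a)) (t * cos (t * x + a)).
Proof.
have := @is_derive1_comp R sin _ x _ _ (is_derive_sin _) (is_derive_affine t x).
by rewrite mulrC.
Qed.

Let is_derive_cosM (y t : R) :
  is_derive t 1 (fun t => cos (t * y + a)) (- sin (t * y + a) * y).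
Proof.
have := @is_derive1_comp R cos _ t _ _ (is_derive_cos _) (is_derive_affine y t).
rewrite [y * t]mulrC; congr is_derive.
by apply/funext => z /=; rewrite mulrC.
Qed.

(** Stein's identity for g = sin (t x + a). *)
Let normal_sin_cos (t : R) :
  \int[N]_x (x * sin (t * x + a)) = s ^+ 2 * (t * F t).
Proof.
have [i1 i2] := integrable_trig t.
pose f x := x * sin (t * x + a) - s ^+ 2 * (t * cos (t * x + a)).
have intf : N.-integrable setT (EFin \o f).
  rewrite (_ : EFin \o f = (fun x => (x * sin (t * x + a))%:E) \-
     (fun x => (s ^+ 2 * t)%:E * (cos (t * x + a))%:E))%E; last first.
    by apply/funext => x; rewrite /f /= EFinB mulrA EFinM.
  by apply: integrableB => //; exact: integrableZl.
have f0 : (\int[N]_x (f x)%:E = 0)%E.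
  apply: (cvg_unique _ (cvg_integral_symitv intf)) => //.
  pose b n := sin (t * n%:R + a) - sin (t * - n%:R + a).
  have : ((- s ^+ 2 * (b n * pdf n%:R))%:E)%E @[n --> \oo] --> (0%:E)%E.
    apply: cvg_EFin; first exact: nearW.
    rewrite -[X in _ --> X](mulr0 (- s ^+ 2)); apply: cvgMl_tmp.
    apply/norm_cvg0P; apply: (@squeeze_cvgr _ _ _ _ (cst 0)
      (fun n => 2 * (n%:R * pdf n%:R))).
    - near=> n; rewrite normr_ge0/= normrM mulrA.
      rewrite [`|pdf _|]ger0_norm ?normal_pdf_ge0// ler_wpM2r ?normal_pdf_ge0//.
      rewrite (@le_trans _ _ 2)//.
        rewrite (le_trans (ler_normB _ _))//.
        by have -> : 2 = 1 + 1 :> R by []; rewrite lerD// sin_max.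
      by rewrite ler_peMr// ler1n; near: n; exact: nbhs_infty_gt.
    - exact: cvg_cst.
    - by rewrite -[X in _ --> X](mulr0 2); apply: cvgMl_tmp; exact: cvg_normal_pdf.
  apply: cvg_trans; apply: near_eq_cvg; near=> n.
  have n0 : 0 < n%:R :> R by rewrite ltr0n; near: n; exact: nbhs_infty_gt.
  rewrite (stein n0 (is_derive_sinM t)).
    by rewrite mulrA.
  move=> x; apply: cvgMl_tmp; apply: (@continuous_comp _ _ _ (fun x : R => t * x + a) cos).
    apply: cvgD; last exact: cvg_cst.
    by apply: cvgMl_tmp; exact: cvg_id.
  exact: continuous_cos.
have : \int[N]_x f x = 0 by rewrite /Rintegral f0.
rewrite /f RintegralB//; last first.
  rewrite (_ : EFin \o _ = (fun x => (s ^+ 2 * t)%:E * (cos (t * x + a))%:E))%E; last first.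
    by apply/funext => x /=; rewrite mulrA.
  exact: integrableZl.
under [X in _ - X = _]eq_Rintegral do rewrite mulrA.
rewrite RintegralZl// => /eqP; rewrite subr_eq0 => /eqP ->.
by rewrite mulrA.
Unshelve. all: by end_near. Qed.

(** Differentiation under the integral, followed by [normal_sin_cos]: F solves
    F' = - s^2 t F. *)
Let is_derive_F (t : R) : is_derive t 1 F (- (s ^+ 2 * (t * F t))).
Proof.
pose f (t x : R) := cos (t * x + a).
have d1E t' x : partial1of2 f t' x = - (x * sin (t' * x + a)).
  rewrite partial1of2E; have [_ ->] := is_derive_cosM x t'.
  by rewrite mulNr mulrC.
have It : `]t - 1, t + 1[%classic t by rewrite /= in_itv/=; apply/andP; split; lra.
have intf x : `]t - 1, t + 1[%classic x -> N.-integrable setT (EFin \o f x).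
  by move=> _; have [] := integrable_trig x.
have der x y : `]t - 1, t + 1[%classic x -> [set: R] y -> derivable (f ^~ y) x 1.
  by move=> _ _; have [] := is_derive_cosM y x.
have intG : N.-integrable setT (EFin \o (fun x : R => `|x|)).
  exact: (integrable_abse integrable_normal_id).
have Gub x y : `]t - 1, t + 1[%classic x -> [set: R] y -> `|partial1of2 f x y| <= `|y|.
  by move=> _ _; rewrite d1E normrN normrM ler_piMr//; exact: sin_max.
split.
  exact: (derivable_under_integral measurableT It intf der (fun y => normr_ge0 y) intG Gub).
rewrite -derive1E.
rewrite (differentiation_under_integral measurableT It intf der (fun y => normr_ge0 y) intG Gub).
under eq_Rintegral do rewrite d1E -mulN1r.
rewrite RintegralZl//; last by have [] := integrable_trig t.
by rewrite normal_sin_cos mulN1r.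
Qed.

(** The differential equation of F makes F t * exp (s^2 t^2 / 2) constant; the
    phase a covers the real and the imaginary part at once. *)
Lemma normal_charfun :
  \int[N]_x cos (x + a) = cos a * expR (- (2^-1 * s ^+ 2)).
Proof.
pose g t := F t * expR (2^-1 * s ^+ 2 * t ^+ 2).
have dg (t : R) : is_derive t 1 g 0.
  have dF := is_derive_F t.
  have -> : g = F * (expR \o (fun t => (2^-1 * s ^+ 2) * t ^+ 2)) by [].
  apply: is_derive_eq; rewrite /GRing.scale/=.
  set e := expR _; by field.
have := @is_derive_0_is_cst R g 0 1 dg.
rewrite /g expr0n/= mulr0 expR0 mulr1 expr1n mulr1.
have -> : F 0 = cos a.
  rewrite /F; under eq_Rintegral do rewrite mul0r add0r.
  by rewrite Rintegral_cst// [X in _ * fine X]probability_setT mulr1.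
have -> : F 1 = \int[N]_x cos (x + a).
  by apply: eq_Rintegral => x _; rewrite mul1r.
move=> ->; have e0 : expR (2^-1 * s ^+ 2) != 0 by rewrite gt_eqF ?expR_gt0.
by rewrite expRN mulfK.
Qed.

End normal_moments.

Lemma normal_mean (R : realType) (s : R) : s != 0 ->
  (\int[normal_prob (0 : R) s]_x x%:E = 0)%E.
Proof.
move=> s0; apply: (cvg_unique _ (cvg_integral_symitv (integrable_normal_id s0))) => //.
apply: cvg_near_cst; near=> n.
have n0 : 0 < n%:R :> R by rewrite ltr0n; near: n; exact: nbhs_infty_gt.
have -> : (0 : \bar R) = (- s ^+ 2 * ((cst 1 : R -> R) n%:R - (cst 1 : R -> R) (- n%:R)) * normal_pdf (0 : R) s n%:R)%:E.
  by rewrite subrr mulr0 mul0r.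
rewrite -(stein s0 (g := cst 1) (g' := cst 0) n0); last exact: cst_continuous.
  by apply: eq_integral => x _; rewrite /= mulr1 mulr0 subr0.
Unshelve. all: by end_near. Qed.

(** * Independent sums *)

Section product_probability.
Context d1 d2 (T1 : measurableType d1) (T2 : measurableType d2) (R : realType).
Variables (P : probability T1 R) (Q : probability T2 R).

Definition prodprob : set (T1 * T2) -> \bar R := (P \x Q)%E.

HB.instance Definition _ := Measure.on prodprob.

Let prodprob_setT : prodprob setT = 1%E.
Proof.
rewrite /prodprob -setXTT product_measure1E// -[RHS]mule1.
by congr (_ * _)%E; exact: probability_setT.
Qed.

HB.instance Definition _ :=
  Measure_isProbability.Build _ _ _ prodprob prodprob_setT.

Lemma integral_prodprob_bmfun (f : T1 * T2 -> R) : bmfun f ->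
  \int[prodprob]_z f z = \int[P]_x \int[Q]_y f (x, y).
Proof.
move=> bf; have [mf [M fM]] := bf.
rewrite /Rintegral -(@integral12_prod_meas1 _ _ _ _ _ P Q (EFin \o f)); last first.
  exact: (bmfun_integrable prodprob bf).
congr fine; apply: eq_integral => x _; rewrite /fubini_F /= fineK//.
apply: integrable_fin_num => //; apply: (@bounded_integrable _ _ _ Q _ M) => //.
by apply: measurableT_comp => //; exact: measurable_pair1.
Qed.

Lemma integral_prodprob_mul (f : T1 -> R) (g : T2 -> R) : bmfun f -> bmfun g ->
  \int[prodprob]_z (f z.1 * g z.2) = (\int[P]_x f x) * (\int[Q]_y g y).
Proof.
move=> bf bg; have [mf [M fM]] := bf; have [mg [K gK]] := bg.
rewrite integral_prodprob_bmfun; last first.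
  split.
    by apply: measurable_funM; exact: measurableT_comp.
  by exists (M * K) => z; rewrite normrM ler_pM.
rewrite /=.
under eq_Rintegral do rewrite (RintegralZl _ _ (bmfun_integrable Q bg))//.
by rewrite (RintegralZr _ _ (bmfun_integrable P bf)).
Qed.

End product_probability.

Section charfun_real.
Context d (T : measurableType d) (R : realType) (P : probability T R).

(** Real and imaginary part of the expectation of exp (i f).  Keeping them
    separate avoids complex-valued integration. *)
Definition cf_cos (f : T -> R) : R := \int[P]_x cos (f x).
Definition cf_sin (f : T -> R) : R := \int[P]_x sin (f x).

End charfun_real.

Section charfun_sum.
Context d1 d2 (T1 : measurableType d1) (T2 : measurableType d2) (R : realType).
Variables (P : probability T1 R) (Q : probability T2 R).
Variables (f : T1 -> R) (g : T2 -> R).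
Hypotheses (mf : measurable_fun setT f) (mg : measurable_fun setT g).

Let bprod (u : T1 -> R) (v : T2 -> R) : bmfun u -> bmfun v ->
  bmfun (fun z : T1 * T2 => u z.1 * v z.2).
Proof.
move=> [mu [M uM]] [mv [K vK]]; split.
  by apply: measurable_funM; exact: measurableT_comp.
by exists (M * K) => z; rewrite normrM ler_pM.
Qed.

Lemma cf_cos_sum : cf_cos (prodprob P Q) (fun z => f z.1 + g z.2) =
  cf_cos P f * cf_cos Q g - cf_sin P f * cf_sin Q g.
Proof.
have [cf sf cg sg] := And4 (bmfun_cos mf) (bmfun_sin mf) (bmfun_cos mg) (bmfun_sin mg).
rewrite /cf_cos /cf_sin -!integral_prodprob_mul//.
rewrite -RintegralB//; try by apply: (bmfun_integrable (prodprob P Q)); exact: (bprod (u := fun x => _ (f x)) (v := fun x => _ (g x))).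
by apply: eq_Rintegral => z _; rewrite cosD.
Qed.

Lemma cf_sin_sum : cf_sin (prodprob P Q) (fun z => f z.1 + g z.2) =
  cf_sin P f * cf_cos Q g + cf_cos P f * cf_sin Q g.
Proof.
have [cf sf cg sg] := And4 (bmfun_cos mf) (bmfun_sin mf) (bmfun_cos mg) (bmfun_sin mg).
rewrite /cf_cos /cf_sin -!integral_prodprob_mul//.
rewrite -RintegralD//; try by apply: (bmfun_integrable (prodprob P Q)); exact: (bprod (u := fun x => _ (f x)) (v := fun x => _ (g x))).
by apply: eq_Rintegral => z _; rewrite sinD.
Qed.

End charfun_sum.

(** With z = x + i y the hypotheses say (U + i V)' = z (U + i V); hence
    (U + i V) exp (- z t) has derivative 0 and is constant. *)
Lemma linear_ode (R : realType) (x y : R) (U V : R -> R) :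
  (forall t, is_derive t (1 : R) U (x * U t - y * V t)) ->
  (forall t, is_derive t (1 : R) V (y * U t + x * V t)) ->
  U 0 = 1 -> V 0 = 0 ->
  U 1 = expR x * cos y /\ V 1 = expR x * sin y.
Proof.
move=> dU dV U0 V0.
pose C (t : R) := cos (y * t); pose S (t : R) := sin (y * t).
pose E (t : R) := expR (- x * t).
have dC (t : R) : is_derive t (1 : R) C (- S t * y).
  exact: (@is_derive1_comp R cos (fun x => y * x) t _ _ (is_derive_cos _) (is_derive_mull y t)).
have dS (t : R) : is_derive t (1 : R) S (C t * y).
  exact: (@is_derive1_comp R sin (fun x => y * x) t _ _ (is_derive_sin _) (is_derive_mull y t)).
have dE (t : R) : is_derive t (1 : R) E (E t * - x).
  exact: (@is_derive1_comp R expR (fun z => - x * z) t _ _ (is_derive_expR _) (is_derive_mull (- x) t)).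
have dA (t : R) : is_derive t (1 : R) ((U * C + V * S) * E) 0.
  apply: (is_derive_eq (is_deriveM (is_deriveD (is_deriveM (dU t) (dC t)) (is_deriveM (dV t) (dS t))) (dE t))).
  have -> : (U * C + V * S) t = U t * C t + V t * S t by [].
  by rewrite /GRing.scale/=; ring.
have dB (t : R) : is_derive t (1 : R) ((V * C - U * S) * E) 0.
  apply: (is_derive_eq (is_deriveM (is_deriveB (is_deriveM (dV t) (dC t)) (is_deriveM (dU t) (dS t))) (dE t))).
  have -> : (V * C - U * S) t = V t * C t - U t * S t by [].
  by rewrite /GRing.scale/=; ring.
have C0 : C 0 = 1 by rewrite /C mulr0 cos0.
have S0 : S 0 = 0 by rewrite /S mulr0 sin0.
have E0 : E 0 = 1 by rewrite /E mulr0 expR0.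
have A1 : (U 1 * C 1 + V 1 * S 1) * E 1 = 1.
  transitivity ((U 0 * C 0 + V 0 * S 0) * E 0); last by rewrite U0 V0 C0 S0 E0; ring.
  exact: (@is_derive_0_is_cst R ((U * C + V * S) * E) 1 0 dA).
have B1 : (V 1 * C 1 - U 1 * S 1) * E 1 = 0.
  transitivity ((V 0 * C 0 - U 0 * S 0) * E 0); last by rewrite U0 V0 C0 S0 E0; ring.
  exact: (@is_derive_0_is_cst R ((V * C - U * S) * E) 1 0 dB).
have cs1 : C 1 ^+ 2 + S 1 ^+ 2 = 1 by exact: cos2Dsin2.
have ex : expR x * E 1 = 1 by rewrite /E mulr1 expRN mulfV// gt_eqF// expR_gt0.
have -> : cos y = C 1 by rewrite /C mulr1.
have -> : sin y = S 1 by rewrite /S mulr1.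
move: (U 1) (V 1) (C 1) (S 1) (E 1) (expR x) A1 B1 cs1 ex => u v c s e f A1 B1 cs1 ex.
have A2 : u * c + v * s = f.
  by rewrite -[LHS]mulr1 -ex mulrCA A1 mulr1.
have B2 : v * c - u * s = 0.
  by rewrite -[LHS]mulr1 -ex mulrCA B1 mulr0.
have vc : v * c = u * s by apply/eqP; rewrite -subr_eq0 B2.
split.
  transitivity (u * (c ^+ 2 + s ^+ 2)); first by rewrite cs1 mulr1.
  have -> : f * c = u * c ^+ 2 + (v * c) * s by rewrite -A2; ring.
  by rewrite vc; ring.
transitivity (v * (c ^+ 2 + s ^+ 2)); first by rewrite cs1 mulr1.
have -> : f * s = v * s ^+ 2 + (u * s) * c by rewrite -A2; ring.
by rewrite -vc; ring.
Qed.

(** The exponential series of z = x + i y, where c n and s n are the real and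
    imaginary parts of z ^ n.  The power series in t solves the equation of
    [linear_ode]; its value at t = 1 is the sum. *)
Section cexp_series.
Variables (R : realType) (x y : R) (c s : nat -> R).
Hypotheses (c0 : c 0%N = 1) (s0 : s 0%N = 0).
Hypothesis cS : forall n, c n.+1 = x * c n - y * s n.
Hypothesis sS : forall n, s n.+1 = y * c n + x * s n.

Let r := `|x| + `|y|.

Let cs_bnd n : `|c n| <= r ^+ n /\ `|s n| <= r ^+ n.
Proof.
elim: n => [|n [cn sn]]; first by rewrite c0 s0 normr0 normr1 expr0.
rewrite cS sS exprS /r mulrDl; split.
  by rewrite (le_trans (ler_normB _ _))// !normrM lerD// ler_wpM2l.
by rewrite (le_trans (ler_normD _ _))// !normrM addrC lerD// ler_wpM2l.
Qed.

Let cvg_pseries_bnd (u : nat -> R) (K : R) : 0 <= K ->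
  (forall n, `|u n| <= K * r ^+ n) ->
  forall t, cvgn (pseries (fun n => u n / n`!%:R) t).
Proof.
move=> K0 uK t; apply: normed_cvg.
apply: (@series_le_cvg _ _ (fun n => K * exp_coeff (r * `|t|) n)).
- by move=> n; rewrite normr_ge0.
- move=> n; rewrite mulr_ge0// /exp_coeff /= divr_ge0// exprn_ge0// mulr_ge0//.
  by rewrite addr_ge0.
- move=> n; rewrite /exp_coeff /= !normrM normrX normfV normr_nat exprMn.
  rewrite mulrAC !mulrA ler_wpM2r ?invr_ge0 ?ler0n//.
  by rewrite ler_wpM2r// exprn_ge0.
- have := @is_cvg_seriesZ _ (exp_coeff (r * `|t|)) K.
  by apply; exact: is_cvg_series_exp_coeff.
Qed.

Let diffs_fact (u : nat -> R) :
  pseries_diffs (fun n => u n / n`!%:R) = (fun n => u n.+1 / n`!%:R).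
Proof.
apply/funext => n; rewrite /pseries_diffs factS natrM invfM.
by rewrite mulrCA !mulrA mulfK// pnatr_eq0.
Qed.

Let r0 : 0 <= r. Proof. by rewrite addr_ge0. Qed.

Let is_derive_series (u : nat -> R) : (forall n, `|u n| <= r ^+ n) ->
  forall t, is_derive t (1 : R) (fun t => limn (pseries (fun n => u n / n`!%:R) t))
    (limn (pseries (fun n => u n.+1 / n`!%:R) t)).
Proof.
move=> ub t; rewrite -diffs_fact; apply: (@pseries_snd_diffs _ _ (`|t| + 1)).
- by apply: (cvg_pseries_bnd (K := 1)) => // n; rewrite mul1r.
- rewrite diffs_fact; apply: (cvg_pseries_bnd (u := fun n => u n.+1) (K := r)) => // n.
  by rewrite -exprS.
- rewrite !diffs_fact; apply: (cvg_pseries_bnd (u := fun n => u n.+2) (K := r ^+ 2)).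
    by rewrite exprn_ge0.
  by move=> n; rewrite -exprD.
- by rewrite [ltRHS]ger0_norm ?addr_ge0// ltrDl.
Qed.

Let U t := limn (pseries (fun n => c n / n`!%:R) t).
Let V t := limn (pseries (fun n => s n / n`!%:R) t).

Let cvgc t : cvgn (pseries (fun n => c n / n`!%:R) t).
Proof. by apply: (cvg_pseries_bnd (K := 1)) => // n; rewrite mul1r; have [] := cs_bnd n. Qed.
Let cvgs t : cvgn (pseries (fun n => s n / n`!%:R) t).
Proof. by apply: (cvg_pseries_bnd (K := 1)) => // n; rewrite mul1r; have [] := cs_bnd n. Qed.

Let lin_series (a b : R) (t : R) :
  limn (pseries (fun n => (a * c n + b * s n) / n`!%:R) t) = a * U t + b * V t.
Proof.
have -> : pseries (fun n => (a * c n + b * s n) / n`!%:R) t =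
  (fun n => a * pseries (fun n => c n / n`!%:R) t n + b * pseries (fun n => s n / n`!%:R) t n).
  apply/funext => n; rewrite /pseries /series /= !mulr_sumr -big_split/=.
  by apply: eq_bigr => i _; rewrite !mulrDl !mulrA.
apply/cvg_lim => //; apply: cvgD; apply: cvgMl_tmp; [exact: cvgc|exact: cvgs].
Qed.

Let dU t : is_derive t (1 : R) U (x * U t - y * V t).
Proof.
have := is_derive_series (fun n => (cs_bnd n).1) t.
under [X in is_derive _ _ _ (limn (pseries X _))]eq_fun do rewrite cS -mulNr.
by rewrite lin_series mulNr.
Qed.

Let dV t : is_derive t (1 : R) V (y * U t + x * V t).
Proof.
have := is_derive_series (fun n => (cs_bnd n).2) t.
under [X in is_derive _ _ _ (limn (pseries X _))]eq_fun do rewrite sS.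
by rewrite lin_series.
Qed.

Let pseries0 (u : nat -> R) : limn (pseries (fun n => u n / n`!%:R) 0) = u 0%N.
Proof.
apply/cvg_lim => //; apply: cvg_near_cst; near=> n.
have n0 : (0 < n)%N by near: n; exact: nbhs_infty_gt.
rewrite /pseries /series /= big_ltn// big_nat big1 ?addr0.
  by rewrite expr0 mulr1 fact0 divr1.
by move=> i /andP[i0 _]; rewrite expr0n gtn_eqF// mulr0.
Unshelve. all: by end_near. Qed.

Let rotated1 : U 1 = expR x * cos y /\ V 1 = expR x * sin y.
Proof. by apply: (linear_ode dU dV); rewrite /U /V pseries0. Qed.

Let pseries_at1 (u : nat -> R) : pseries (fun n => u n / n`!%:R) 1 =
  series (fun n => u n / n`!%:R).
Proof.
rewrite /pseries (_ : (fun n => u n / n`!%:R * 1 ^+ n) = (fun n => u n / n`!%:R))//.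
by apply/funext => n; rewrite expr1n mulr1.
Qed.

Lemma cexp_series_re : series (fun n => c n / n`!%:R) @ \oo --> expR x * cos y.
Proof.
have [<- _] := rotated1; have := @cvgc 1; rewrite /U pseries_at1.
exact.
Qed.

Lemma cexp_series_im : series (fun n => s n / n`!%:R) @ \oo --> expR x * sin y.
Proof.
have [_ <-] := rotated1; have := @cvgs 1; rewrite /V pseries_at1.
exact.
Qed.

End cexp_series.

(** * Image laws, convolutions and compound Poisson laws *)

Section law.
Context d1 d2 (T1 : measurableType d1) (T2 : measurableType d2) (R : realType).
Variables (P : probability T1 R) (f : T1 -> T2) (mf : measurable_fun setT f).

Definition law : probability T2 R := distribution P (mfun_Sub (mem_set mf)).

Lemma lawE A : law A = P (f @^-1` A).
Proof. by []. Qed.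

Lemma ge0_integral_law (g : T2 -> \bar R) : measurable_fun setT g ->
  (forall y, 0 <= g y)%E -> (\int[law]_y g y = \int[P]_x g (f x))%E.
Proof. by move=> mg g0; rewrite ge0_integral_distribution. Qed.

Lemma Rintegral_law (g : T2 -> R) : bmfun g -> \int[law]_y g y = \int[P]_x g (f x).
Proof.
move=> [mg [M gM]]; rewrite /Rintegral integral_distribution//.
  exact/measurable_EFinP.
apply: (@bounded_integrable _ _ _ P (g \o f) M); first exact: measurableT_comp.
by move=> t; exact: gM.
Qed.

End law.

Section law_coords.
Context d (T : measurableType d) (R : realType) (I : finType).
Variables (P : probability T R) (f : T -> coords R I) (mf : measurable_fun setT f).

Lemma cf_cos_law c : cf_cos (law P mf) (lin c) = cf_cos P (fun t => lin c (f t)).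
Proof.
rewrite /cf_cos Rintegral_law//; apply: bmfun_cos.
exact: (measurable_lin c (@measurable_id _ (coords R I) setT)).
Qed.

Lemma cf_sin_law c : cf_sin (law P mf) (lin c) = cf_sin P (fun t => lin c (f t)).
Proof.
rewrite /cf_sin Rintegral_law//; apply: bmfun_sin.
exact: (measurable_lin c (@measurable_id _ (coords R I) setT)).
Qed.

End law_coords.

Section convolution_power.
Variables (R : realType) (I : finType).
Local Notation T := (coords R I).

Definition coords_add (z : T * T) : T := fun i => z.1 i + z.2 i.

Lemma measurable_coords_add : measurable_fun setT coords_add.
Proof.
apply: measurable_coords => i; apply: measurable_funD.
- exact: (measurableT_comp (measurable_coord i) measurable_fst).
- exact: (measurableT_comp (measurable_coord i) measurable_snd).
Qed.

Definition conv (P Q : probability T R) : probability T R :=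
  law (prodprob P Q) measurable_coords_add.

Definition dirac0 : probability T R := dirac ((fun=> 0) : T).

Definition convpow (nu : probability T R) (n : nat) : probability T R :=
  iter n (conv nu) dirac0.

Let measurable_lin0 c : measurable_fun setT (lin c : T -> R).
Proof. exact: (measurable_lin c (@measurable_id _ T setT)). Qed.

Lemma cf_cos_conv P Q c : cf_cos (conv P Q) (lin c) =
  cf_cos P (lin c) * cf_cos Q (lin c) - cf_sin P (lin c) * cf_sin Q (lin c).
Proof.
rewrite cf_cos_law -(cf_cos_sum _ _ (measurable_lin0 c) (measurable_lin0 c)).
by apply: eq_Rintegral => z _; rewrite linDr.
Qed.

Lemma cf_sin_conv P Q c : cf_sin (conv P Q) (lin c) =
  cf_sin P (lin c) * cf_cos Q (lin c) + cf_cos P (lin c) * cf_sin Q (lin c).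
Proof.
rewrite cf_sin_law -(cf_sin_sum _ _ (measurable_lin0 c) (measurable_lin0 c)).
by apply: eq_Rintegral => z _; rewrite linDr.
Qed.

Let lin_0 c : lin c ((fun=> 0) : T) = 0.
Proof. by rewrite /lin big1// => i _; rewrite mulr0. Qed.

Lemma cf_cos_dirac0 c : cf_cos dirac0 (lin c) = 1.
Proof.
rewrite /cf_cos /Rintegral integral_dirac//; last first.
  by apply/measurable_EFinP; have [] := bmfun_cos (measurable_lin0 c).
by rewrite diracT mul1e lin_0 cos0.
Qed.

Lemma cf_sin_dirac0 c : cf_sin dirac0 (lin c) = 0.
Proof.
rewrite /cf_sin /Rintegral integral_dirac//; last first.
  by apply/measurable_EFinP; have [] := bmfun_sin (measurable_lin0 c).
by rewrite diracT mul1e lin_0 sin0.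
Qed.

End convolution_power.

Lemma eseries_EFin (R : realType) (u : nat -> R) (l : R) :
  series u @ \oo --> l -> (\sum_(n <oo) (u n)%:E = l%:E)%E.
Proof.
move=> ul; apply/cvg_lim => //.
have -> : (fun n => \sum_(0 <= k < n) (u k)%:E)%E = EFin \o series u.
  by apply/funext => n; rewrite /series /= sumEFin.
by apply: cvg_EFin => //; exact: nearW.
Qed.

(** The compound Poisson law: the sum of a Poisson(k) number of independent
    vectors of law nu. *)
Section compound_poisson.
Variables (R : realType) (I : finType) (nu : probability (coords R I) R).
Variables (k : R) (k0 : 0 <= k).
Local Notation T := (coords R I).

Definition poisson_weight (n : nat) : R := expR (- k) * (k ^+ n / n`!%:R).

Lemma poisson_weight_ge0 n : 0 <= poisson_weight n.
Proof. by rewrite mulr_ge0 ?expR_ge0// divr_ge0// exprn_ge0. Qed.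

Definition cpoisson_term (n : nat) : {measure set T -> \bar R} :=
  mscale (NngNum (poisson_weight_ge0 n)) (convpow nu n).

Definition cpoisson : set T -> \bar R := mseries cpoisson_term 0.

HB.instance Definition _ := Measure.on cpoisson.

Lemma series_poisson_weight : series poisson_weight @ \oo --> (1 : R).
Proof.
have -> : poisson_weight = expR (- k) *: exp_coeff k by [].
have -> : 1 = expR (- k) * expR k by rewrite -expRD addNr expR0.
have -> : series (expR (- k) *: exp_coeff k) = (fun n => expR (- k) * series (exp_coeff k) n).
  by apply/funext => n; rewrite /series /= mulr_sumr.
apply: cvgMl_tmp; exact: is_cvg_series_exp_coeff.
Qed.

Let cpoisson_setT : cpoisson setT = 1%E.
Proof.
rewrite /cpoisson /mseries -(eseries_EFin series_poisson_weight).
apply: eq_eseriesr => n _ /=; rewrite /mscale /= -[RHS]mule1.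
by congr (_ * _)%E; exact: probability_setT.
Qed.

HB.instance Definition _ :=
  Measure_isProbability.Build _ _ _ cpoisson cpoisson_setT.

Lemma ge0_integral_cpoisson (f : T -> \bar R) : measurable_fun setT f ->
  (forall x, 0 <= f x)%E ->
  (\int[cpoisson]_x f x =
   \sum_(n <oo) (poisson_weight n)%:E * \int[convpow nu n]_x f x)%E.
Proof.
move=> mf f0; rewrite ge0_integral_measure_series//.
by apply: eq_eseriesr => n _; rewrite ge0_integral_mscale.
Qed.

(** The integral against a series of measures is known for nonnegative functions
    only; it is applied to 1 + f, and the total mass is subtracted. *)
Lemma Rintegral_cpoisson (f : T -> R) (l : R) : measurable_fun setT f ->
  (forall x, `|f x| <= 1) ->
  series (fun n => poisson_weight n * \int[convpow nu n]_x f x) @ \oo --> l ->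
  \int[cpoisson]_x f x = l.
Proof.
move=> mf f1 fl.
have bf : bmfun f by split => //; exists 1.
have b1 : bmfun (fun _ : T => 1 : R) by exact: bmfun_cst.
have E1 : (\int[cpoisson]_x (1 + f x)%:E = (1 + l)%:E)%E.
  rewrite ge0_integral_cpoisson//=; last first.
  - by move=> x; rewrite lee_fin; move: (f1 x); rewrite ler_norml; lra.
  - by apply/measurable_EFinP; exact: measurable_funD.
  rewrite -(@eseries_EFin R (fun n => poisson_weight n + poisson_weight n * \int[convpow nu n]_x f x)).
    apply: eq_eseriesr => n _.
    have -> : (\int[convpow nu n]_x (1 + f x)%:E = (1 + \int[convpow nu n]_x f x)%:E)%E.
      rewrite -[in RHS](Rintegral1 (convpow nu n)) -RintegralD//;
        [|exact: (bmfun_integrable _ b1)|exact: (bmfun_integrable _ bf)].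
      rewrite /Rintegral fineK//; apply: integrable_fin_num => //.
      exact: (bmfun_integrable _ (bmfunD b1 bf)).
    by rewrite -EFinM mulrDr mulr1.
  have -> : series (fun n => poisson_weight n + poisson_weight n * \int[convpow nu n]_x f x) =
    (fun m => series poisson_weight m + series (fun n => poisson_weight n * \int[convpow nu n]_x f x) m).
    by apply/funext => m; rewrite /series /= big_split.
  by apply: cvgD => //; exact: series_poisson_weight.
have : \int[cpoisson]_x (1 + f x) = 1 + l by rewrite /Rintegral E1.
rewrite RintegralD//; [|exact: (bmfun_integrable _ b1)|exact: (bmfun_integrable _ bf)].
by rewrite Rintegral1 => /addrI.
Qed.

Section cf.
Variable c : I -> R.
(** With z the characteristic function of nu at c, that of the n-th convolution
    power is z ^ n, so [cn] and [sn] are the parts of (k z) ^ n and the series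
    sums to exp (k z - k). *)
Let x := k * cf_cos nu (lin c).
Let y := k * cf_sin nu (lin c).
Let cn n := k ^+ n * cf_cos (convpow nu n) (lin c).
Let sn n := k ^+ n * cf_sin (convpow nu n) (lin c).

Let c0 : cn 0 = 1. Proof. by rewrite /cn expr0 mul1r cf_cos_dirac0. Qed.
Let s0 : sn 0 = 0. Proof. by rewrite /sn expr0 mul1r cf_sin_dirac0. Qed.
Let cS n : cn n.+1 = x * cn n - y * sn n.
Proof. by rewrite /cn /sn /= cf_cos_conv exprS /x /y; ring. Qed.
Let sS n : sn n.+1 = y * cn n + x * sn n.
Proof. by rewrite /cn /sn /= cf_sin_conv exprS /x /y; ring. Qed.

Let measurable_lin0 : measurable_fun setT (lin c : T -> R).
Proof. exact: (measurable_lin c (@measurable_id _ T setT)). Qed.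

Lemma cf_cos_cpoisson : cf_cos cpoisson (lin c) =
  expR (k * cf_cos nu (lin c) - k) * cos (k * cf_sin nu (lin c)).
Proof.
rewrite -/x -/y; apply: Rintegral_cpoisson.
- by have [] := bmfun_cos measurable_lin0.
- by move=> z; exact: cos_max.
have -> : series (fun n => poisson_weight n * \int[convpow nu n]_z cos (lin c z)) =
    (fun m => expR (- k) * series (fun n => cn n / n`!%:R) m).
  apply/funext => m; rewrite /series /= mulr_sumr; apply: eq_bigr => i _.
  by rewrite /poisson_weight /cn /cf_cos; ring.
rewrite addrC expRD -mulrA; apply: cvgMl_tmp.
exact: (cexp_series_re c0 s0 cS sS).
Qed.

Lemma cf_sin_cpoisson : cf_sin cpoisson (lin c) =
  expR (k * cf_cos nu (lin c) - k) * sin (k * cf_sin nu (lin c)).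
Proof.
rewrite -/x -/y; apply: Rintegral_cpoisson.
- by have [] := bmfun_sin measurable_lin0.
- by move=> z; exact: sin_max.
have -> : series (fun n => poisson_weight n * \int[convpow nu n]_z sin (lin c z)) =
    (fun m => expR (- k) * series (fun n => sn n / n`!%:R) m).
  apply/funext => m; rewrite /series /= mulr_sumr; apply: eq_bigr => i _.
  by rewrite /poisson_weight /sn /cf_sin; ring.
rewrite addrC expRD -mulrA; apply: cvgMl_tmp.
exact: (cexp_series_im c0 s0 cS sS).
Qed.

End cf.

End compound_poisson.

(** * Submultiplicative moments of convolutions *)

Section supnorm.
Variables (R : realType) (I : finType).
Implicit Type x y : I -> R.

Definition supnorm x : R := \big[Num.max/0]_i `|x i|.

Lemma supnorm_ge0 x : 0 <= supnorm x.
Proof. exact: bigmax_ge_id. Qed.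

Lemma supnorm_coord x i : `|x i| <= supnorm x.
Proof. exact: le_bigmax. Qed.

Lemma supnorm_le x r : 0 <= r -> (forall i, `|x i| <= r) -> supnorm x <= r.
Proof. by move=> r0 xr; apply: bigmax_le. Qed.

Lemma supnormD x y : supnorm (fun i => x i + y i) <= supnorm x + supnorm y.
Proof.
apply: supnorm_le => [|i]; first by rewrite addr_ge0// supnorm_ge0.
by rewrite (le_trans (ler_normD _ _))// lerD// supnorm_coord.
Qed.

Lemma supnormZ a x : supnorm (fun i => a * x i) = `|a| * supnorm x.
Proof.
have [->|a0] := eqVneq a 0.
  rewrite normr0 mul0r; apply/eqP; rewrite eq_le supnorm_ge0 andbT.
  by apply: supnorm_le => // i; rewrite mul0r normr0.
have a1 : 0 < `|a| by rewrite normr_gt0.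
apply/eqP; rewrite eq_le; apply/andP; split.
  apply: supnorm_le => [|i]; first by rewrite mulr_ge0// supnorm_ge0.
  by rewrite normrM ler_wpM2l// supnorm_coord.
rewrite -ler_pdivlMl//; apply: supnorm_le => [|i].
  by rewrite mulr_ge0 ?invr_ge0// supnorm_ge0.
rewrite ler_pdivlMl// -normrM.
exact: (supnorm_coord (fun i => a * x i)).
Qed.

Lemma measurable_supnorm d (T : measurableType d) (f : I -> T -> R) :
  (forall i, measurable_fun setT (f i)) ->
  measurable_fun setT (fun t => supnorm (f ^~ t)).
Proof.
move=> mf; rewrite /supnorm; elim: (index_enum I) => [|i s IH].
  rewrite (_ : (fun t => _) = cst 0); first exact: measurable_cst.
  by apply/funext => t; rewrite big_nil.
under eq_fun do rewrite big_cons.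
apply: measurable_maxr => //.
exact: (measurableT_comp (@normr_measurable R setT) (mf i)).
Qed.

End supnorm.

Lemma ge0_integral_prodprob_mul d1 d2 (T1 : measurableType d1) (T2 : measurableType d2)
    (R : realType) (P : probability T1 R) (Q : probability T2 R)
    (f : T1 -> \bar R) (g : T2 -> \bar R) :
  measurable_fun setT f -> measurable_fun setT g ->
  (forall x, 0 <= f x)%E -> (forall x, 0 <= g x)%E ->
  (\int[prodprob P Q]_z (f z.1 * g z.2) = \int[P]_x f x * \int[Q]_y g y)%E.
Proof.
move=> mf mg f0 g0.
rewrite (@fubini_tonelli1 _ _ _ _ _ P Q (fun z => f z.1 * g z.2)%E); last 2 first.
- apply: emeasurable_funM.
    exact: (measurableT_comp mf measurable_fst).
  exact: (measurableT_comp mg measurable_snd).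
- by move=> z; rewrite mule_ge0.
rewrite /fubini_F /=.
under eq_integral do rewrite ge0_integralZl//.
by rewrite ge0_integralZr// integral_ge0.
Qed.

Section submultiplicative_moments.
Variables (R : realType) (I : finType) (h : R -> R) (C : R).
Hypotheses (h0 : forall t, 0 <= h t) (hnd : {homo h : s t / s <= t}).
Hypotheses (C0 : 0 < C) (hC : forall t s, h (t + s) <= C * h t * h s).
Local Notation T := (coords R I).

Lemma measurable_h : measurable_fun setT h.
Proof. by apply: nondecreasing_measurable => // s t; exact: hnd. Qed.

Let hN (x : T) : \bar R := (h (supnorm x))%:E.

Lemma measurable_h_supnorm : measurable_fun setT hN.
Proof.
apply/measurable_EFinP; apply: (measurableT_comp measurable_h).
apply: (measurable_supnorm (f := fun i (x : T) => x i)) => i.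
exact: measurable_coord.
Qed.

Let hN0 x : (0 <= hN x)%E. Proof. by rewrite lee_fin. Qed.

Let ihN0 (P : probability T R) : (0 <= \int[P]_x hN x)%E.
Proof. exact: integral_ge0. Qed.

(** h (|x + y|) <= h (|x| + |y|) <= C h (|x|) h (|y|), and the two factors are
    independent. *)
Lemma integral_h_conv (P Q : probability T R) :
  (\int[conv P Q]_x hN x <= C%:E * (\int[P]_x hN x * \int[Q]_x hN x))%E.
Proof.
rewrite ge0_integral_law//; last exact: measurable_h_supnorm.
have m1 : measurable_fun setT (fun z : T * T => hN z.1 * hN z.2)%E.
  apply: emeasurable_funM.
    exact: (measurableT_comp measurable_h_supnorm measurable_fst).
  exact: (measurableT_comp measurable_h_supnorm measurable_snd).
rewrite -ge0_integral_prodprob_mul//; try exact: measurable_h_supnorm.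
rewrite -ge0_integralZl//; first last.
- by rewrite lee_fin ltW.
- by move=> z _; rewrite mule_ge0.
apply: ge0_le_integral => //.
- exact: (measurableT_comp measurable_h_supnorm (@measurable_coords_add R I)).
- exact: measurable_funeM.
- move=> z _; rewrite /hN -!EFinM lee_fin mulrA.
  apply: le_trans (hC _ _); apply: hnd; exact: supnormD.
Qed.

Lemma integral_h_dirac (a : T) : (\int[dirac a]_x hN x = hN a)%E.
Proof.
rewrite integral_dirac//; last exact: measurable_h_supnorm.
by rewrite diracT mul1e.
Qed.

Lemma integral_h_convpow (nu : probability T R) (J : R) (n : nat) :
  (\int[nu]_x hN x <= J%:E)%E ->
  (\int[convpow nu n]_x hN x <= (h 0 * (C * J) ^+ n)%:E)%E.
Proof.
move=> hJ; have J0 : 0 <= J by rewrite -lee_fin (le_trans (ihN0 nu) hJ).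
elim: n => [|n IH].
  rewrite integral_h_dirac expr0 mulr1 /hN lee_fin; apply: hnd.
  by apply: supnorm_le => // i; rewrite normr0.
apply: (le_trans (integral_h_conv _ _)).
have -> : h 0 * (C * J) ^+ n.+1 = C * (J * (h 0 * (C * J) ^+ n)).
  by rewrite exprS; ring.
rewrite EFinM lee_pmul2l//; rewrite EFinM.
by apply: lee_pmul.
Qed.

(** Averaging h 0 * (C J) ^ n against the Poisson weights gives an exponential. *)
Lemma integral_h_cpoisson (nu : probability T R) (k J : R) (k0 : 0 <= k) :
  (\int[nu]_x hN x <= J%:E)%E ->
  (\int[cpoisson nu k0]_x hN x <= (h 0 * expR (k * (C * J) - k))%:E)%E.
Proof.
move=> hJ; have J0 : 0 <= J by rewrite -lee_fin (le_trans (ihN0 nu) hJ).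
rewrite ge0_integral_cpoisson//; last exact: measurable_h_supnorm.
rewrite -(@eseries_EFin R (fun n => poisson_weight k n * (h 0 * (C * J) ^+ n))); last first.
  have -> : series (fun n => poisson_weight k n * (h 0 * (C * J) ^+ n)) =
     (fun m => h 0 * expR (- k) * series (exp_coeff (k * (C * J))) m).
    apply/funext => m; rewrite /series /= mulr_sumr; apply: eq_bigr => i _.
    rewrite /poisson_weight /exp_coeff /=; move: (C * J) (h 0) => a b.
    by rewrite exprMn; ring.
  have -> : h 0 * expR (k * (C * J) - k) = h 0 * expR (- k) * expR (k * (C * J)).
    by rewrite -mulrA -expRD [- k + _]addrC.
  apply: cvgMl_tmp.
  exact: is_cvg_series_exp_coeff.
apply: lee_nneseries => [n _ _|n _].
  by rewrite mule_ge0// lee_fin poisson_weight_ge0.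
rewrite [leRHS]EFinM; apply: lee_wpmul2l; last exact: integral_h_convpow.
by rewrite lee_fin poisson_weight_ge0.
Qed.

End submultiplicative_moments.

(** * Gaussian families *)

Section gaussian_functional.
Context d (T : measurableType d) (R : realType) (P : probability T R).
Variables (f : T -> R) (s : R).
Hypothesis mf : measurable_fun setT f.
Hypothesis fN : forall A : set (measurableTypeR R), measurable A ->
  P (f @^-1` A) = centered_normal s A.

(** The hypothesis on N lets both branches of [centered_normal], the Dirac mass
    and the normal law, be treated as probabilities. *)
Let ge0_integral_f (N : probability (measurableTypeR R) R) :
  (forall A, measurable A -> centered_normal s A = N A) ->
  forall g : R -> \bar R, measurable_fun setT g -> (forall x, 0 <= g x)%E ->
  (\int[P]_x g (f x) = \int[N]_x g x)%E.
Proof.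
move=> cN g mg g0.
rewrite -(@ge0_integral_law _ _ T (measurableTypeR R) R P f mf g)//.
by apply: eq_measure_integral => A mA _; exact: (etrans (fN mA) (cN A mA)).
Qed.

Let Rintegral_f (N : probability (measurableTypeR R) R) :
  (forall A, measurable A -> centered_normal s A = N A) ->
  forall g : R -> R, bmfun (g : measurableTypeR R -> R) ->
  \int[P]_x g (f x) = \int[N]_x g x.
Proof.
move=> cN g bg.
rewrite -(@Rintegral_law _ _ T (measurableTypeR R) R P f mf g)//.
congr fine; apply: eq_measure_integral => A mA _.
exact: (etrans (fN mA) (cN A mA)).
Qed.

Lemma gaussian_moments :
  (\int[P]_x (f x ^+ 2)%:E = (s ^+ 2)%:E)%E /\
  (forall a, \int[P]_x cos (f x + a) = cos a * expR (- (2^-1 * s ^+ 2))).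
Proof.
have msq : measurable_fun setT (fun x : R => (x ^+ 2)%:E).
  by apply/measurable_EFinP; exact: exprn_measurable.
have sq0 (x : R) : (0 <= (x ^+ 2)%:E)%E by rewrite lee_fin sqr_ge0.
have bcos a : bmfun (fun x : measurableTypeR R => cos (x + a)).
  by apply: bmfun_cos; exact: measurable_funD.
have [s0|s0] := eqVneq s 0.
  have cN A : measurable A -> centered_normal s A = dirac (0 : measurableTypeR R) A.
    by rewrite /centered_normal s0 eqxx.
  split=> [|a].
    rewrite (ge0_integral_f cN msq sq0) integral_dirac//.
    by rewrite diracT mul1e expr0n s0 expr0n.
  rewrite (Rintegral_f cN (bcos a)) /Rintegral integral_dirac//; last first.
    by apply/measurable_EFinP; have [] := bcos a.
  by rewrite diracT mul1e /= add0r s0 expr0n mulr0 oppr0 expR0 mulr1.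
have cN A : measurable A -> centered_normal s A = normal_prob 0 s A.
  by rewrite /centered_normal (negbTE s0).
split=> [|a].
  by rewrite (ge0_integral_f cN msq sq0) normal_second_moment.
by rewrite (Rintegral_f cN (bcos a)) normal_charfun.
Qed.

Lemma gaussian_cf_cos : cf_cos P f = expR (- (2^-1 * s ^+ 2)).
Proof.
have [_ /(_ 0)] := gaussian_moments; rewrite cos0 mul1r => <-.
by apply: eq_Rintegral => x _; rewrite addr0.
Qed.

Lemma gaussian_cf_sin : cf_sin P f = 0.
Proof.
have [_ /(_ (- (pi / 2)))] := gaussian_moments.
rewrite cosN cos_pihalf mul0r => <-.
by apply: eq_Rintegral => x _; rewrite cosBpihalf.
Qed.

Let integrable_f : P.-integrable setT (EFin \o f).
Proof.
have i2 : P.-integrable setT (fun x => 1%:E + (f x ^+ 2)%:E)%E.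
  apply: integrableD => //; first exact: (bmfun_integrable P (bmfun_cst _ 1)).
  apply/integrableP; split; first by apply/measurable_EFinP; exact: measurable_funX.
  under eq_integral do rewrite /= ger0_norm ?sqr_ge0//.
  by rewrite gaussian_moments.1 ltry.
apply: (le_integrable _ _ _ i2) => //; first exact/measurable_EFinP.
move=> x _; rewrite /= lee_fin [leRHS]ger0_norm ?addr_ge0 ?sqr_ge0//.
rewrite -(real_normK (num_real (f x))); have := sqr_ge0 (`|f x| - 1).
by rewrite sqrrB1; have := normr_ge0 (f x); nra.
Qed.

Let mean_f : (\int[P]_x (f x)%:E = 0)%E.
Proof.
transitivity (\int[law P (mf : measurable_fun setT (f : T -> measurableTypeR R))]_x x%:E)%E.
  by rewrite integral_distribution.
have [s0|s0] := eqVneq s 0.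
  rewrite (eq_measure_integral (dirac (0 : measurableTypeR R))); last first.
    by move=> A mA _; apply: (etrans (fN mA)); rewrite /centered_normal s0 eqxx.
  by rewrite integral_dirac// mule0.
rewrite (eq_measure_integral (normal_prob (0 : R) s)); first exact: normal_mean.
by move=> A mA _; apply: (etrans (fN mA)); rewrite /centered_normal (negbTE s0).
Qed.

(** The covariance is centered at the mean, which vanishes here. *)
Lemma gaussian_covariance : covariance P f f = (\int[P]_x (f x ^+ 2)%:E)%E.
Proof.
rewrite unlock unlock mean_f; apply: eq_integral => x _.
by rewrite expr2 -[f x in RHS]subr0.
Qed.

End gaussian_functional.

(** Joint Gaussianity: every linear combination has a centered normal law. *)
Definition gaussian_family d (T : measurableType d) (R : realType)
    (P : probability T R) (I : finType) (f : I -> T -> R) : Prop :=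
  (forall i, measurable_fun setT (f i)) /\
  forall c, exists s, forall A : set (measurableTypeR R), measurable A ->
    P ((fun t => lin c (f ^~ t)) @^-1` A) = centered_normal s A.

Section rotation.
Context d (T : measurableType d) (R : realType) (P : probability T R).
Variables (I : finType) (f : I -> T -> R).
Hypothesis gf : gaussian_family P f.

Let mf i : measurable_fun setT (f i). Proof. by have [] := gf. Qed.

Let mlin c : measurable_fun setT (fun t => lin c (f ^~ t)).
Proof.
apply: (@measurable_lin R I d T c (fun t => (f ^~ t) : coords R I)).
exact: measurable_coords.
Qed.

Definition variance_lin (c : I -> R) : R := \int[P]_t (lin c (f ^~ t)) ^+ 2.

(** The law of a linear combination is determined by its second moment; the
    standard deviation of the definition is eliminated here. *)
Lemma variance_linE c :
  [/\ (\int[P]_t ((lin c (f ^~ t)) ^+ 2)%:E = (variance_lin c)%:E)%E,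
      cf_cos P (fun t => lin c (f ^~ t)) = expR (- (2^-1 * variance_lin c)) &
      cf_sin P (fun t => lin c (f ^~ t)) = 0].
Proof.
have [s hs] := gf.2 c.
have [sq _] := gaussian_moments (mlin c) hs.
have vE : variance_lin c = s ^+ 2 by rewrite /variance_lin /Rintegral sq.
by split; rewrite ?vE ?sq//; [exact: gaussian_cf_cos|exact: (gaussian_cf_sin (s := s))].
Qed.

(** The parallelogram identity for the quadratic form [variance_lin]; it is what
    makes the rotation by 45 degrees preserve the law of an independent pair. *)
Lemma variance_parallelogram (c1 c2 : I -> R) (r : R) : r ^+ 2 = 2^-1 ->
  variance_lin (fun i => r * (c1 i + c2 i)) + variance_lin (fun i => r * (c1 i - c2 i)) =
  variance_lin c1 + variance_lin c2.
Proof.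
move=> r2; apply: EFin_inj; rewrite !EFinD.
have H c := let: And3 e _ _ := variance_linE c in e.
rewrite -!H.
have msq c : measurable_fun setT (fun t => ((lin c (f ^~ t)) ^+ 2)%:E).
  by apply/measurable_EFinP; exact: measurable_funX.
have sq0 c t : (0 <= ((lin c (f ^~ t)) ^+ 2)%:E)%E by rewrite lee_fin sqr_ge0.
rewrite -!ge0_integralD//; try by move=> t _; exact: sq0.
apply: eq_integral => t _; rewrite -!EFinD; congr EFin.
rewrite !linZ linDl linBl !exprMn r2.
by move: (lin c1 _) (lin c2 _) => a b; field.
Qed.

Let sumvec (u v : I -> R) : coords R (I + I)%type :=
  fun k => match k with inl i => u i | inr i => v i end.

Let lin_sumvec c (u v : I -> R) :
  lin c (sumvec u v) = lin (fun i => c (inl i)) u + lin (fun i => c (inr i)) v.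
Proof. by rewrite /lin big_sumType. Qed.

Variable r : R.
Hypothesis r2 : r ^+ 2 = 2^-1.

(** U is an independent pair (X, Y) of copies of the family, and V is the rotated
    pair ((X + Y) / sqrt 2, (X - Y) / sqrt 2). *)
Let U (z : T * T) : coords R (I + I)%type := sumvec (f ^~ z.1) (f ^~ z.2).
Let V (z : T * T) : coords R (I + I)%type :=
  sumvec (fun i => r * (f i z.1 + f i z.2)) (fun i => r * (f i z.1 - f i z.2)).

Let mf1 i : measurable_fun setT (fun z : T * T => f i z.1).
Proof. exact: (measurableT_comp (mf i) measurable_fst). Qed.

Let mf2 i : measurable_fun setT (fun z : T * T => f i z.2).
Proof. exact: (measurableT_comp (mf i) measurable_snd). Qed.

Let mU : measurable_fun setT U.
Proof. by apply: measurable_coords => -[i|i] /=. Qed.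

Let mV : measurable_fun setT V.
Proof.
apply: measurable_coords => -[i|i] /=; apply: measurable_funM => //.
  exact: measurable_funD.
exact: measurable_funB.
Qed.

Let linV c z : lin c (V z) =
  lin (fun i => r * (c (inl i) + c (inr i))) (f ^~ z.1) +
  lin (fun i => r * (c (inl i) - c (inr i))) (f ^~ z.2).
Proof.
rewrite lin_sumvec /lin -!big_split/=; apply: eq_bigr => i _; ring.
Qed.

Let linU c z : lin c (U z) =
  lin (fun i => c (inl i)) (f ^~ z.1) + lin (fun i => c (inr i)) (f ^~ z.2).
Proof. exact: lin_sumvec. Qed.

Let cf_sum c1 c2 :
  cf_cos (prodprob P P) (fun z => lin c1 (f ^~ z.1) + lin c2 (f ^~ z.2)) =
    expR (- (2^-1 * (variance_lin c1 + variance_lin c2))) /\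
  cf_sin (prodprob P P) (fun z => lin c1 (f ^~ z.1) + lin c2 (f ^~ z.2)) = 0.
Proof.
have [_ c1E s1E] := variance_linE c1; have [_ c2E s2E] := variance_linE c2.
rewrite (cf_cos_sum P P (mlin c1) (mlin c2)) (cf_sin_sum P P (mlin c1) (mlin c2)).
by rewrite c1E c2E s1E s2E !mul0r !mulr0 subr0 addr0 -expRD mulrDr opprD.
Qed.

(** Both pairs have the same characteristic function, by
    [variance_parallelogram]. *)
Lemma rotation_invariance (A : set (coords R (I + I)%type)) : measurable A ->
  prodprob P P (U @^-1` A) = prodprob P P (V @^-1` A).
Proof.
move=> mA; rewrite -(lawE _ mU) -(lawE _ mV).
have cfU c : cf_cos (law (prodprob P P) mU) (lin c) =
    expR (- (2^-1 * (variance_lin (fun i => c (inl i)) + variance_lin (fun i => c (inr i))))) /\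
    cf_sin (law (prodprob P P) mU) (lin c) = 0.
  rewrite cf_cos_law cf_sin_law.
  by under [fun t => lin c (U t)]eq_fun do rewrite linU; exact: cf_sum.
have cfV c : cf_cos (law (prodprob P P) mV) (lin c) =
    expR (- (2^-1 * (variance_lin (fun i => c (inl i)) + variance_lin (fun i => c (inr i))))) /\
    cf_sin (law (prodprob P P) mV) (lin c) = 0.
  rewrite cf_cos_law cf_sin_law.
  under [fun t => lin c (V t)]eq_fun do rewrite linV.
  by rewrite -(variance_parallelogram _ _ r2); exact: cf_sum.
apply: (@charfun_unique R _ (law (prodprob P P) mU) (law (prodprob P P) mV)) mA => c.
- by rewrite -/(cf_cos _ _) (cfU c).1 -(cfV c).1.
- by rewrite -/(cf_sin _ _) (cfU c).2 -(cfV c).2.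
Qed.

Let N (t : T) := supnorm (f ^~ t).

Let mN : measurable_fun setT N. Proof. exact: measurable_supnorm. Qed.

Let mNgt t : measurable [set x | t < N x].
Proof. exact: measurable_superlevel. Qed.

Let mNle t : measurable [set x | N x <= t].
Proof. exact: measurable_sublevel. Qed.

Let A0 (a t : R) : set (coords R (I + I)%type) :=
  [set w | supnorm (fun i : I => w (inr i)) <= a] `&`
  [set w | t < supnorm (fun i : I => w (inl i))].

Let mA0 a t : measurable (A0 a t).
Proof.
have ms (g : I -> (I + I)%type) :
    measurable_fun setT (fun w : coords R (I + I)%type => supnorm (fun i : I => w (g i))).
  apply: (measurable_supnorm (f := fun i (w : coords R (I + I)%type) => w (g i))) => i.
  exact: measurable_coord.
apply: measurableI; first exact: (measurable_sublevel (ms inr)).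
exact: (measurable_superlevel (ms inl)).
Qed.

(** If |X - Y| <= a sqrt 2 and |X + Y| > t sqrt 2, then |X| and |Y| both exceed
    (t - a) / sqrt 2.  Rotation invariance turns the probability of the
    hypothesis into the left-hand side. *)
Lemma fernique_inequality a t : 0 <= r ->
  (P [set x | N x <= a]%R * P [set x | t < N x]%R <=
   P [set x | r * (t - a) < N x]%R * P [set x | r * (t - a) < N x]%R)%E.
Proof.
move=> r0.
have lE : prodprob P P (U @^-1` A0 a t) = (P [set x | N x <= a]%R * P [set x | t < N x]%R)%E.
  rewrite muleC -(@product_measure1E _ _ _ _ _ P P _ _ (mNgt t) (mNle a)).
  by congr (product_measure1 _ _ _); apply/seteqP; split => z /= [].
rewrite -lE rotation_invariance//.
rewrite -(@product_measure1E _ _ _ _ _ P P _ _ (mNgt (r * (t - a))) (mNgt (r * (t - a)))).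
have mVA : measurable (V @^-1` A0 a t) by rewrite -[X in measurable X]setTI; exact: mV.
apply: le_measure; rewrite ?inE//; first exact: measurableX.
move=> z [/= h1 h2].
have hd1 : supnorm (fun i => r * (f i z.1 - f i z.2)) <= a by [].
have hs : t < supnorm (fun i => r * (f i z.1 + f i z.2)) by [].
have rr (w : R) : r * (r * 2 * w) = w by rewrite mulrA mulrA -expr2 r2 mulVf// mul1r.
have hd2 : supnorm (fun i => r * (f i z.2 - f i z.1)) <= a.
  apply: le_trans hd1; apply: supnorm_le => [|i]; first exact: supnorm_ge0.
  rewrite (_ : r * _ = - (r * (f i z.1 - f i z.2))); last by ring.
  by rewrite normrN; exact: (supnorm_coord (fun i => r * (f i z.1 - f i z.2))).
have key x y : supnorm (fun i => r * (f i y - f i x)) <= a ->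
    t < supnorm (fun i => r * (f i x + f i y)) -> r * (t - a) < N x.
  move=> h h'.
  have : t < 2 * r * N x + a.
    apply: lt_le_trans h' _.
    have -> : (fun i => r * (f i x + f i y)) =
        (fun i => 2 * r * f i x + r * (f i y - f i x)).
      by apply/funext => i; ring.
    apply: le_trans (supnormD _ _) _; rewrite lerD//.
    by rewrite supnormZ ger0_norm// mulr_ge0.
  rewrite -ltrBlDr => h3.
  have r1 : 0 < r by rewrite lt0r r0 andbT; apply/eqP => re; move: r2; rewrite re expr0n/=; lra.
  rewrite -(ltr_pM2l r1) in h3; apply: lt_le_trans h3 _.
  by rewrite [2 * r]mulrC rr.
split; first exact: key hs.
apply: (key _ z.1) => //.
by under eq_fun do rewrite addrC.
Qed.

End rotation.

(** * Fernique's theorem for submultiplicative moments *)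

(** Bernoulli's inequality for (1 + 1/3) ^ j. *)
Lemma expn_bernoulli3 j : (3 ^ j * (3 + j) <= 3 * 4 ^ j)%N.
Proof.
elim: j => // j IH; rewrite !expnS.
move: IH; set p := (3 ^ j)%N; set q := (4 ^ j)%N => IH.
have : (p * (3 * (3 + j.+1)) <= p * (4 * (3 + j)))%N by rewrite leq_mul2l; lia.
by lia.
Qed.

(** The exponent 4 ^ j eventually dominates any multiple of 3 ^ j; the finitely
    many remaining terms are absorbed by B. *)
Lemma superexp_bound (R : realType) (K : R) : 1 <= K -> exists2 B : R, 0 <= B &
  forall j, K ^+ (3 ^ j.+1) * (4^-1) ^+ (4 ^ j) <= B * (2^-1) ^+ j.
Proof.
move=> K1; pose u j : R := K ^+ (3 ^ j.+1) * (4^-1) ^+ (4 ^ j).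
have u0 j : 0 <= u j by rewrite mulr_ge0 ?exprn_ge0// (le_trans ler01).
pose a := (Num.truncn K).+1.
have Ka : K <= 2 ^+ a.
  rewrite (le_trans (ltW (truncnS_gt K)))//.
  by rewrite -natrX ler_nat ltnW// ltn_expl.
have tail j : (9 * a <= j)%N -> u j <= 2^-1 ^+ j.
  move=> aj.
  have e1 : (a * 3 ^ j.+1 <= 4 ^ j)%N.
    have := expn_bernoulli3 j; rewrite expnS.
    have : (3 ^ j * (9 * a) <= 3 ^ j * (3 + j))%N.
      by rewrite leq_mul2l (leq_trans aj) ?orbT// leq_addl.
    by move=> /leq_trans /[apply]; lia.
  have e2 : K ^+ (3 ^ j.+1) <= 2 ^+ (4 ^ j).
    apply: (@le_trans _ _ ((2 ^+ a) ^+ (3 ^ j.+1))).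
      by rewrite lerXn2r// nnegrE ?exprn_ge0// (le_trans ler01).
    by rewrite -exprM ler_weXn2l// ler1n.
  rewrite /u; apply: (@le_trans _ _ (2 ^+ (4 ^ j) * 4^-1 ^+ (4 ^ j))).
    by rewrite ler_wpM2r// exprn_ge0.
  rewrite -exprMn; have -> : 2 * 4^-1 = 2^-1 :> R by field.
  by rewrite ler_wiXn2l// ?invf_le1// ?ler1n// ltnW// ltn_expl.
pose B := 1 + \sum_(i < 9 * a) u i * 2 ^+ i.
have S0 : 0 <= \sum_(i < 9 * a) u i * 2 ^+ i.
  by apply: sumr_ge0 => i _; rewrite mulr_ge0.
exists B; first by rewrite addr_ge0.
move=> j; have [aj|ja] := leqP (9 * a) j.
  rewrite (le_trans (tail j aj))// ler_peMl ?exprn_ge0//.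
  by rewrite /B lerDl.
rewrite -/(u j) [2^-1 ^+ j]exprVn ler_pdivlMr ?exprn_gt0// /B.
rewrite (bigD1 (Ordinal ja))//= addrCA lerDl addr_ge0//.
by apply: sumr_ge0 => i _; rewrite mulr_ge0.
Qed.

Section fernique.
Variables (R : realType) (h : R -> R) (C : R).
Hypotheses (h0 : forall t, 0 <= h t) (hnd : {homo h : s t / s <= t}).
Hypotheses (C0 : 0 < C) (hC : forall t s, h (t + s) <= C * h t * h s).
Variable a : R.
Hypothesis a0 : 0 < a.

(** One use of [fernique_inequality] multiplies the level by 3/2 and squares the
    tail.  Submultiplicativity controls h at 3/2 of a level only through twice
    that level, hence by a square, which would be a tie; two uses multiply the
    level by 9/4 <= 3 and raise the tail to the fourth power, while C h is at
    most cubed.  The start 20 a makes the loss of a in t - a negligible. *)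
Let tau (j : nat) : R := (9 / 4) ^+ j * (20 * a).

Let tau_gt0 j : 0 < tau j.
Proof. by rewrite mulr_gt0// ?exprn_gt0// ?mulr_gt0. Qed.

Let tauS j : tau j.+1 = 9 / 4 * tau j.
Proof. by rewrite /tau exprS mulrA. Qed.

Let tau_ge j : 20 * a <= tau j.
Proof. by rewrite /tau ler_peMl ?mulr_ge0// ?(ltW a0)// exprn_ege1//; lra. Qed.

Let tau_unbounded (v : R) : exists n, v <= tau n.
Proof.
have bern n : n%:R <= (9 / 4) ^+ n :> R.
  elim: n => [|n IH]; first by rewrite expr0.
  have n1 : 1 <= (9 / 4) ^+ n :> R by rewrite exprn_ege1//; lra.
  by rewrite exprS -natr1; move: IH n1; set q := _ ^+ n; lra.
pose n := (Num.truncn (`|v| / (20 * a))).+1; exists n.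
have A0 : 0 < 20 * a by rewrite mulr_gt0.
rewrite (le_trans (ler_norm v))// /tau -ler_pdivrMr//.
by rewrite (le_trans (ltW (truncnS_gt _)))// bern.
Qed.

Let K : R := 1 + C * h (tau 0).

(** tau j.+1 <= 3 tau j, so submultiplicativity at most cubes C h. *)
Let h_tau j : C * h (tau j) <= K ^+ (3 ^ j).
Proof.
have Kge : 0 <= K by rewrite addr_ge0// mulr_ge0// ltW.
elim: j => [|j IH]; first by rewrite expn0 expr1 /K lerDr.
have Ch0 t : 0 <= C * h t by rewrite mulr_ge0// ltW.
have -> : K ^+ (3 ^ j.+1) = K ^+ (3 ^ j) * K ^+ (3 ^ j) * K ^+ (3 ^ j).
  by rewrite -!exprD expnS; congr (_ ^+ _); lia.
apply: (@le_trans _ _ (C * h (tau j) * (C * h (tau j)) * (C * h (tau j)))).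
  have le1 : h (tau j.+1) <= h (tau j + tau j + tau j).
    by apply: hnd; rewrite tauS; have := tau_gt0 j; lra.
  have le2 : C * h (tau j + tau j + tau j) <= C * h (tau j + tau j) * (C * h (tau j)).
    rewrite -mulrA ler_pM2l// mulrCA mulrA; apply: hC.
  apply: le_trans (ler_wpM2l (ltW C0) le1) _; apply: le_trans le2 _.
  rewrite ler_wpM2r// -mulrA ler_pM2l// mulrCA mulrA; exact: hC.
have Chj := Ch0 (tau j).
by apply: ler_pM => //; [exact: mulr_ge0|exact: ler_pM].
Qed.

(** If tau j < v <= tau j.+1, the j-th term alone bounds h v. *)
Let layer_bound (v : R) : 0 <= v ->
  ((h v)%:E <= (h (tau 0))%:E +
    \sum_(j <oo) (h (tau j.+1) * (tau j < v)%R%:R)%:E)%E.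
Proof.
move=> v0.
have S0 j : (0 <= (h (tau j.+1) * (tau j < v)%R%:R)%:E)%E by rewrite lee_fin mulr_ge0.
have [vt|tv] := leP v (tau 0).
  rewrite -[leLHS]adde0 leeD//; first by rewrite lee_fin hnd.
  exact: nneseries_ge0.
have ex : exists n, v <= tau n by exact: tau_unbounded.
case: (ex_minnP ex) => -[|j] vj min_j.
  by move: (lt_le_trans tv vj); rewrite ltxx.
have tjv : tau j < v.
  by rewrite ltNge; apply/negP => /min_j; rewrite ltnn.
rewrite -[leLHS]add0e leeD//; first by rewrite lee_fin.
apply: le_trans (nneseries_lim_ge j.+1 _); last by move=> k _ _; exact: S0.
rewrite big_nat_recr//= tjv mulr1 -[leLHS]add0e leeD//.
  exact: sume_ge0.
by rewrite lee_fin hnd.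
Qed.

(** The bound M is uniform in the family and in its size: only the probability of
    the ball of radius a enters. *)
Lemma fernique d (T : measurableType d) (P : probability T R) :
  exists M : R, forall (I : finType) (f : I -> T -> R),
  gaussian_family P f -> ((4 / 5)%:E <= P [set x | supnorm (f ^~ x) <= a]%R)%E ->
  (\int[P]_x (h (supnorm (f ^~ x)))%:E <= M%:E)%E.
Proof.
have K1 : 1 <= K by rewrite lerDl mulr_ge0// ltW.
have [B B0 hB] := superexp_bound K1.
exists (h (tau 0) + C^-1 * (B * 2)) => I f gf Pa.
pose N x := supnorm (f ^~ x).
have mN : measurable_fun setT N by apply: measurable_supnorm; have [] := gf.
have mNgt t : measurable [set x | t < N x] by exact: measurable_superlevel.
(* the normalisation 5/4 makes the tail inequality read g (3/2 t) <= g t ^ 2 *)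
pose g t : R := 5 / 4 * fine (P [set x | t < N x]).
have PE t : P [set x | t < N x] = (fine (P [set x | t < N x]))%:E.
  by rewrite fineK// fin_num_measure.
have g_ge0 t : 0 <= g t by rewrite mulr_ge0// fine_ge0.
have g_nincr s t : s <= t -> g t <= g s.
  move=> st; rewrite ler_wpM2l// fine_le ?fin_num_measure//.
  apply: le_measure; rewrite ?inE// => x /=; exact: le_lt_trans.
pose r : R := (Num.sqrt 2)^-1.
have r2 : r ^+ 2 = 2^-1 by rewrite exprVn sqr_sqrtr.
have r0 : 0 <= r by rewrite invr_ge0 sqrtr_ge0.
have gstep t : 20 * a <= t -> g (3 / 2 * t) <= g t ^+ 2.
  move=> at_; have ha : 0 < a := a0.
  have rt : t <= r * (3 / 2 * t - a).
    have u0 : 0 <= 3 / 2 * t - a by lra.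
    have t0 : 0 <= t by lra.
    rewrite -(@ler_pXn2r _ 2)// ?nnegrE ?mulr_ge0// exprMn r2.
    rewrite ler_pdivlMl//; have : 29 / 20 * t <= 3 / 2 * t - a by lra.
    by move: (3 / 2 * t - a) u0 => u u0 tu; nra.
  have := fernique_inequality gf r2 a (3 / 2 * t) r0; rewrite -/N => fi.
  have {}fi : ((4 / 5)%:E * P [set x | (3 / 2 * t < N x)%R] <=
      P [set x | (t < N x)%R] * P [set x | (t < N x)%R])%E.
    apply: le_trans (le_trans fi _); first by rewrite lee_pmul.
    by rewrite lee_pmul//; apply: le_measure; rewrite ?inE// => x /=; exact: le_lt_trans.
  move: fi; rewrite (PE (3 / 2 * t)) (PE t) -!EFinM lee_fin /g exprMn => fi.
  by move: (fine _) (fine _) fi => p q fi; lra.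
have g0 : g (20 * a) <= 4^-1.
  have ha : 0 < a := a0.
  have : (P [set x | 20 * a < N x]%R <= (1 / 5)%:E)%E.
    apply: (@le_trans _ _ (P (~` [set x | N x <= a]))).
      apply: le_measure; rewrite ?inE//.
        by apply: measurableC; exact: measurable_sublevel.
      by move=> x /= h1; apply/negP; rewrite -ltNge; apply: le_lt_trans h1; lra.
    rewrite probability_setC; last exact: measurable_sublevel.
    have -> : ((1 / 5)%:E = 1 - (4 / 5)%:E :> \bar R)%E by rewrite -EFinB; congr EFin; field.
    by apply: leeB.
  by rewrite (PE (20 * a)) lee_fin /g; lra.
have gtau j : g (tau j) <= 4^-1 ^+ (4 ^ j).
  elim: j => [|j IH]; first by rewrite /tau expr0 mul1r expn0 expr1.
  have := gstep _ (tau_ge j) => g1.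
  have : g (3 / 2 * (3 / 2 * tau j)) <= g (3 / 2 * tau j) ^+ 2.
    by apply: gstep; have := tau_ge j; have := tau_gt0 j; have : 0 < a := a0; lra.
  have -> : 3 / 2 * (3 / 2 * tau j) = tau j.+1 by rewrite tauS; field.
  move=> g2; apply: le_trans g2 _.
  have -> : 4^-1 ^+ (4 ^ j.+1) = ((4^-1 ^+ (4 ^ j)) ^+ 2) ^+ 2 :> R.
    by rewrite -!exprM expnS; congr (_ ^+ _); lia.
  rewrite lerXn2r ?nnegrE ?exprn_ge0//.
  by rewrite (le_trans g1)// lerXn2r ?nnegrE ?exprn_ge0.
have mt j : measurable_fun setT (fun x => (h (tau j.+1) * (tau j < N x)%R%:R)%:E).
  apply/measurable_EFinP; apply: measurable_funM => //.
  by rewrite superlevel_indicE; exact: measurable_indic.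
apply: (@le_trans _ _ (\int[P]_x ((h (tau 0))%:E +
    \sum_(j <oo) (h (tau j.+1) * (tau j < N x)%R%:R)%:E))%E).
  apply: ge0_le_integral => //.
  - by move=> x _; rewrite lee_fin.
  - apply/measurable_EFinP; apply: measurableT_comp mN.
    exact: measurable_h.
  - apply: emeasurable_funD => //; apply: ge0_emeasurable_sum => // j x _ _.
    by rewrite lee_fin mulr_ge0.
  - by move=> x _; apply: layer_bound; exact: supnorm_ge0.
rewrite ge0_integralD//; last 3 first.
- by move=> x _; rewrite lee_fin.
- by move=> x _; apply: nneseries_ge0 => j _ _; rewrite lee_fin mulr_ge0.
- apply: ge0_emeasurable_sum => // j x _ _; by rewrite lee_fin mulr_ge0.
rewrite integral_cst// [X in (_ * X)%E]probability_setT mule1 EFinD leeD2l//.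
rewrite integral_nneseries//; last by move=> j x _; rewrite lee_fin mulr_ge0.
have geo : (\sum_(j <oo) (C^-1 * (B * (2^-1) ^+ j))%:E = (C^-1 * (B * 2))%:E)%E.
  apply: eseries_EFin.
  have -> : series (fun j => C^-1 * (B * 2^-1 ^+ j)) =
      (fun n => C^-1 * (B * series (geometric 1 2^-1) n)).
    apply/funext => n; rewrite /series /= !mulr_sumr; apply: eq_bigr => i _.
    by rewrite /geometric /= mul1r.
  apply: cvgMl_tmp; apply: cvgMl_tmp.
  rewrite [X in _ --> X](_ : _ = 1 / (1 - 2^-1)); last by field.
  by apply: cvg_geometric_series; rewrite ger0_norm// invf_lt1// ltr1n.
rewrite -geo; apply: lee_nneseries => [j _ _|j _].
  by apply: integral_ge0 => x _; rewrite lee_fin mulr_ge0.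
have -> : (\int[P]_x (h (tau j.+1) * (tau j < N x)%R%:R)%:E =
    (h (tau j.+1))%:E * P [set x | (tau j < N x)%R])%E.
  have mI : measurable_fun setT (fun x => (\1_[set x | tau j < N x] x)%:E : \bar R).
    by apply/measurable_EFinP; exact: measurable_indic.
  rewrite -[P _]/(P _) -[in RHS](setIT [set x | (tau j < N x)%R]) -integral_indic//.
  rewrite -ge0_integralZl//; last by rewrite lee_fin.
  apply: eq_integral => x _; rewrite -EFinM; congr (_ * _)%:E.
  exact: (congr1 (@^~ x) (superlevel_indicE N (tau j))).
rewrite (PE (tau j)) -EFinM lee_fin ler_pdivlMl// mulrA.
apply: le_trans (hB j); rewrite ler_pM ?mulr_ge0 ?(ltW C0) ?fine_ge0//.
apply: le_trans (gtau j); rewrite /g ler_peMl ?fine_ge0//; lra.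
Qed.

End fernique.

(** * Functionals on a Banach space *)

Section hahn_banach.
Context (R : realType) (X : normedModType R) (x0 : X).

(** Functionals defined on a subspace and dominated by the norm, encoded by their
    graphs so that a chain has its union as an upper bound.  The first clause is
    conditional because the union of the empty chain is empty. *)
Let partial_graph (G : set (X * R)) : Prop :=
  [/\ forall p, G p -> G (x0, `|x0|),
      forall p, G p -> p.2 <= `|p.1| &
      forall r p q, G p -> G q -> G (r *: p.1 + q.1, r * p.2 + q.2)].

(** Extension to one more dimension: the value c at z must lie above every
    b - |y - z| and below every |y + z| - b with (y, b) in A, which the triangle
    inequality allows. *)
Let extend (A : set (X * R)) (z : X) : partial_graph A -> A !=set0 ->
  exists c, partial_graph [set p | exists q t, A q /\ p = (q.1 + t *: z, q.2 + t * c)].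
Proof.
move=> [Ax0 Ale Alin] [a Aa].
have A0 : A (0, 0).
  have := Alin (-1) _ _ Aa Aa.
  by rewrite scaleN1r mulN1r !addNr.
have Asc r p : A p -> A (r *: p.1, r * p.2).
  by move=> Ap; have := Alin r _ _ Ap A0; rewrite /= !addr0.
have Aadd p q : A p -> A q -> A (p.1 + q.1, p.2 + q.2).
  by move=> Ap Aq; have := Alin 1 _ _ Ap Aq; rewrite /= scale1r mul1r.
pose S := [set p.2 - `|p.1 - z| | p in A].
have Sub p : A p -> ubound S (`|p.1 + z| - p.2).
  move=> Ap _ [q Aq <-].
  rewrite lerBlDr addrAC lerBrDr; apply: le_trans (Ale _ (Aadd _ _ Aq Ap)) _.
  rewrite [leRHS]addrC.
  have -> : (q.1 + p.1, q.2 + p.2).1 = (q.1 - z) + (p.1 + z) by rewrite /= addrACA addNr addr0.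
  exact: ler_normD.
have supS : has_sup S.
  by split; [exists (0 - `|0 - z|); exists (0, 0)|exists (`|a.1 + z| - a.2); exact: Sub].
pose c := sup S.
have cP p : A p -> p.2 + c <= `|p.1 + z|.
  move=> Ap; rewrite -lerBrDl; apply: ge_sup; first exact: supS.1.
  exact: Sub.
have cN p : A p -> p.2 - c <= `|p.1 - z|.
  move=> Ap; rewrite lerBlDr addrC -lerBlDr.
  by apply: ub_le_sup; [exact: supS.2|exists p].
exists c; split.
- by move=> _ [q [t [Aq _]]]; exists (x0, `|x0|), 0; split; [exact: (Ax0 q)|rewrite /= scale0r mul0r !addr0].
- move=> _ [q [t [Aq ->]]] /=.
  have [t0|t0|->] := ltrgtP t 0; last first.
  + by rewrite mul0r scale0r !addr0; exact: Ale.
  + have := cP _ (Asc t^-1 _ Aq); rewrite /= -(ler_pM2l t0) mulrDr mulVKf ?gt_eqF//.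
    move=> /le_trans; apply; rewrite -{1}(gtr0_norm t0) -normrZ scalerDr scalerA divff ?gt_eqF//.
    by rewrite scale1r.
  + have nt : 0 < - t by rewrite oppr_gt0.
    have := cN _ (Asc (- t)^-1 _ Aq); rewrite /= -(ler_pM2l nt) mulrBr mulVKf ?gt_eqF//.
    rewrite mulNr opprK => /le_trans; apply.
    rewrite -{1}(gtr0_norm nt) -normrZ scalerBr scalerA divff ?gt_eqF//.
    by rewrite scale1r scaleNr opprK.
- move=> r _ _ [p [s [Ap ->]]] [q [t [Aq ->]]].
  exists (r *: p.1 + q.1, r * p.2 + q.2), (r * s + t); split; first exact: Alin.
  rewrite /=; congr (_, _); last by ring.
  by rewrite scalerDr scalerDl scalerA addrACA.
Qed.

Theorem hahn_banach : exists rho : dual X,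
  rho x0 = `|x0| /\ forall y, `|rho y| <= `|y|.
Proof.
have [F FP Ftot|A [[Ax0 Ale Alin] Amax]] := @Zorn_bigcup (X * R)%type partial_graph.
  split.
  - by move=> p [G FG Gp]; exists G => //; have [h _ _] := FP _ FG; exact: (h p).
  - by move=> p [G FG Gp]; have [_ h _] := FP _ FG; exact: h.
  - move=> r p q [G FG Gp] [H FH Hq].
    have [GH|HG] := Ftot _ _ FG FH.
      by exists H => //; have [_ _] := FP _ FH; apply => //; exact: GH.
    by exists G => //; have [_ _] := FP _ FG; apply => //; exact: HG.
(* an empty maximal graph would be extended by the line through x0 *)
have Ane : A !=set0.
  apply/set0P/eqP => A0; apply: (Amax [set p | exists r, p = (r *: x0, r * `|x0|)]).
    rewrite A0; split => // /(_ (0, 0)); apply.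
    by exists 0; rewrite scale0r mul0r.
  split.
  - by move=> _ _; exists 1; rewrite scale1r mul1r.
  - by move=> _ [r ->]; rewrite /= normrZ ler_wpM2r ?ler_norm.
  - move=> r _ _ [s ->] [t ->]; exists (r * s + t) => /=.
    by rewrite scalerA -scalerDl mulrDl mulrA.
have tot z : exists b, A (z, b).
  apply: contrapT => nz; have [//|c Pc] := extend z _ Ane.
  apply: (Amax _ _ Pc); split.
    by move=> -[y b] Ap; exists (y, b), 0; rewrite /= scale0r mul0r !addr0.
  have [a Aa] := Ane; move=> /(_ (z, c)) Az; apply: nz; exists c; apply: Az.
  exists (0, 0), 1; rewrite /= scale1r mul1r !add0r; split => //.
  by have := Alin (-1) _ _ Aa Aa; rewrite scaleN1r mulN1r !addNr.
have Aabs p : A p -> `|p.2| <= `|p.1|.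
  move=> Ap; rewrite ler_norml Ale// andbT lerNl.
  have := Ale _ (Alin (-2) _ _ Ap Ap) => /=.
  rewrite (_ : -2 *: p.1 + p.1 = - p.1); last first.
    by rewrite -{2}(scale1r p.1) -scalerDl (_ : -2 + 1 = -1 :> R) ?scaleN1r//; ring.
  by rewrite normrN (_ : -2 * p.2 + p.2 = - p.2)//; ring.
have fnl y b b' : A (y, b) -> A (y, b') -> b = b'.
  move=> h h'; have := Aabs _ (Alin (-1) _ _ h h') => /=.
  by rewrite scaleN1r mulN1r addNr normr0 normr_le0 addrC subr_eq0 => /eqP.
pose f y := projT1 (cid (tot y)).
have fA y : A (y, f y) by rewrite /f; case: cid.
have lf : linear (f : X -> R^o).
  by move=> r x y; apply: (fnl (r *: x + y)) => //; exact: Alin (fA x) (fA y).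
pose F : {linear X -> R^o} := HB.pack (f : X -> R^o) (GRing.isLinear.Build _ _ _ _ _ lf).
have cF : continuous F.
  apply/linear_bounded_continuous/linear_boundedP; near=> r => x.
  apply: le_trans (Aabs _ (fA x)) _.
  by rewrite ler_peMl//; near: r; exact: nbhs_pinfty_ge.
exists (Dual cF); split; last by move=> y; exact: Aabs (fA y).
have [a Aa] := Ane.
exact: fnl (fA x0) (Ax0 _ Aa).
Unshelve. all: by end_near. Qed.

End hahn_banach.

Lemma dual_lin (R : realType) (X : normedModType R) (I : finType)
    (rho : I -> dual X) (c : I -> R) :
  exists sigma : dual X, forall x, sigma x = lin c (fun i => rho i x).
Proof.
pose f x : R^o := lin c (fun i => rho i x).
have lf : linear f.
  move=> r x y; rewrite /f /lin scaler_sumr -big_split; apply: eq_bigr => i _.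
  by rewrite /= linearP mulrDr mulrCA.
pose F : {linear X -> R^o} := HB.pack f (GRing.isLinear.Build _ _ _ _ _ lf).
have cF : continuous F.
  move=> x; rewrite /F /= /f /lin; apply: cvg_big => [|i _]; first exact: add_continuous.
  by apply: cvgMr; exact: dual_continuous.
by exists (Dual cF).
Qed.

Section borel_facts.
Context (R : realType) (X : completeNormedModType R).

Lemma borel_open (A : set X) : open A -> measurable (A : set (borel X)).
Proof. by move=> oA; apply: sub_sigma_algebra. Qed.

Lemma borel_compact (K : set X) : compact K -> measurable (K : set (borel X)).
Proof.
move=> cK; rewrite -[K]setCK; apply: measurableC; apply: borel_open.
by rewrite openC; apply: compact_closed => //; exact: norm_hausdorff.
Qed.

Lemma borel_continuous (f : X -> R) : continuous f ->
  measurable_fun setT (f : borel X -> R).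
Proof.
move=> /continuousP cf; apply: (measurability _ (RGenOpens.measurableE R)).
move=> _ [_ [a [b ->] <-]]; rewrite setTI; apply: borel_open.
by apply: cf; exact: interval_open.
Qed.

Lemma borel_dual (rho : dual X) : measurable_fun setT (rho : borel X -> R).
Proof. by apply: borel_continuous; exact: dual_continuous. Qed.

Lemma borel_norm : measurable_fun setT (fun x : borel X => `|(x : X)|).
Proof. by apply: borel_continuous; exact: norm_continuous. Qed.

(** Cover K by finitely many balls of radius 1/2 and take at each centre a
    functional that attains the norm there; moving from the centre to a point of
    its ball costs 1/2 twice. *)
Lemma compact_norming (K : set X) : compact K ->
  exists (I : finType) (rho : I -> dual X),
    (forall i y, `|rho i y| <= `|y|) /\
    forall x, K x -> `|x| <= supnorm (fun i => rho i x) + 1.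
Proof.
rewrite compact_cover => cK.
have [||D _ KD] := cK X setT (fun y => ball y 2^-1).
- by move=> i _; exact: ball_open.
- by move=> x _; exists x => //; apply: ballxx.
pose g (y : X) := projT1 (cid (hahn_banach y)).
have gE y : g y y = `|y| by rewrite /g; case: cid => ? [].
have gle y z : `|g y z| <= `|z| by rewrite /g; case: cid => ? [].
exists (seq_sub (finmap.enum_fset D)), (fun i => g (ssval i)); split => // x Kx.
have [y /= yD] := KD _ Kx; rewrite -ball_normE/= => xy.
have yle : `|y| <= supnorm (fun i : seq_sub (finmap.enum_fset D) => g (ssval i) x) + 2^-1.
  have h := supnorm_coord (fun i : seq_sub (finmap.enum_fset D) => g (ssval i) x) (SeqSub yD).
  have h2 := gle y (y - x).
  have h3 : g y y = g y x + g y (y - x) by rewrite -linearD/= addrC subrK.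
  rewrite -gE h3 lerD//.
    exact: le_trans (ler_norm _) h.
  exact: le_trans (ler_norm _) (le_trans h2 (ltW xy)).
have -> : x = y - (y - x) by rewrite subKr.
apply: le_trans (ler_normB _ _) _.
rewrite subKr.
apply: le_trans (lerD yle (ltW xy)) _.
by rewrite -addrA lerD2l; lra.
Qed.

Lemma radon_tight (mu : probability (borel X) R) (e : R) : radon mu -> 0 < e ->
  exists K : set X, [/\ compact K, ((1 - e)%:E <= mu K)%E &
    (mu (~` K : set (borel X)) <= e%:E)%E].
Proof.
move=> rmu e0.
have h : mu setT = _ := rmu setT measurableT; rewrite probability_setT in h.
have : ((1 - e)%:E < ereal_sup [set mu K | K in [set K : set X | compact K /\ K `<=` setT]])%E.
  by rewrite -h lte_fin ltrBlDr ltrDl.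
move=> /ereal_sup_gt[_ [K [cK _] <-] hK].
exists K; split => //; first exact: ltW.
rewrite probability_setC; last exact: borel_compact.
have fK := fin_num_measure mu _ (borel_compact cK).
have gen (x : \bar R) : x \is a fin_num -> ((1 - e)%:E < x)%E -> (1 - x <= e%:E)%E.
  by case: x => // r _; rewrite lte_fin -EFinB lee_fin; lra.
exact: gen fK hK.
Qed.

End borel_facts.

(** * Infinitely divisible laws with finite jump measure *)

Section infinitely_divisible_coords.
Variables (R : realType) (I : finType).
Local Notation T := (coords R I).
Variables (D : T) (G nu : probability T R) (k : R) (k0 : 0 <= k).

Definition infdiv : probability T R := conv (dirac D) (conv G (cpoisson nu k0)).

Lemma cf_infdiv c v :
  cf_cos G (lin c) = expR (- (2^-1 * v)) -> cf_sin G (lin c) = 0 ->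
  cf_cos infdiv (lin c) = expR (- (2^-1 * v) + k * (cf_cos nu (lin c) - 1)) *
    cos (lin c D + k * cf_sin nu (lin c)) /\
  cf_sin infdiv (lin c) = expR (- (2^-1 * v) + k * (cf_cos nu (lin c) - 1)) *
    sin (lin c D + k * cf_sin nu (lin c)).
Proof.
move=> Gc Gs.
have ml : measurable_fun setT (lin c : T -> R).
  exact: (measurable_lin c (@measurable_id _ T setT)).
have Dc : cf_cos (dirac D) (lin c) = cos (lin c D).
  rewrite /cf_cos /Rintegral integral_dirac//; last first.
    by apply/measurable_EFinP; have [] := bmfun_cos ml.
  by rewrite diracT mul1e.
have Ds : cf_sin (dirac D) (lin c) = sin (lin c D).
  rewrite /cf_sin /Rintegral integral_dirac//; last first.
    by apply/measurable_EFinP; have [] := bmfun_sin ml.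
  by rewrite diracT mul1e.
have -> : k * (cf_cos nu (lin c) - 1) = k * cf_cos nu (lin c) - k by ring.
rewrite !(cf_cos_conv, cf_sin_conv) Gc Gs Dc Ds cf_cos_cpoisson cf_sin_cpoisson.
by rewrite cosD sinD (expRD (- (2^-1 * v))); split; ring.
Qed.

Lemma integral_h_infdiv (h : R -> R) (C a b J : R) :
  (forall t, 0 <= h t) -> {homo h : s t / s <= t} -> 0 < C ->
  (forall t s, h (t + s) <= C * h t * h s) ->
  supnorm D <= a ->
  (\int[G]_x (h (supnorm x))%:E <= b%:E)%E ->
  (\int[nu]_x (h (supnorm x))%:E <= J%:E)%E ->
  (\int[infdiv]_x (h (supnorm x))%:E <=
   (C * (h a * (C * (b * (h 0 * expR (k * (C * J) - k))))))%:E)%E.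
Proof.
move=> h0 hnd C0 hC Da Gb nuJ.
have i0 (P : probability T R) : (0 <= \int[P]_x (h (supnorm x))%:E)%E.
  by apply: integral_ge0 => x _; rewrite lee_fin.
apply: le_trans (integral_h_conv h0 hnd C0 hC _ _) _.
rewrite EFinM lee_pmul2l// EFinM; apply: lee_pmul => //.
  by rewrite (integral_h_dirac hnd) lee_fin; exact: hnd.
apply: le_trans (integral_h_conv h0 hnd C0 hC _ _) _.
rewrite EFinM lee_pmul2l// EFinM; apply: lee_pmul => //.
exact: integral_h_cpoisson.
Qed.

End infinitely_divisible_coords.

Section complex_bridge.
Variables (R : realType) (X : completeNormedModType R).

Lemma cexp_i (r : R) : cexp ('i%C * (r%:C)%C) = (cos r +i* sin r)%C.
Proof.
rewrite /cexp /= !mul0r !mul1r subr0 !add0r expR0.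
by congr (_ +i* _)%C => /=; ring.
Qed.

Lemma charfunE (mu : probability (borel X) R) (rho : dual X) :
  charfun mu rho = (cf_cos mu (rho : borel X -> R) +i* cf_sin mu (rho : borel X -> R))%C.
Proof.
rewrite /charfun /cintegral /cf_cos /cf_sin.
by congr (_ +i* _)%C; apply: eq_Rintegral => x _; rewrite cexp_i.
Qed.

(** The compensator in [Psi]; its integral against a finite jump measure is a
    drift. *)
Definition truncated (rho : dual X) (u : X) : R := rho u * \1_(ball (0 : X) 1) u.

Lemma truncated_le (rho : dual X) (M : R) : 0 <= M ->
  (forall y, `|rho y| <= M * `|y|) -> forall u, `|truncated rho u| <= M.
Proof.
move=> M0 hM u; rewrite /truncated normrM indicE.
case: (asboolP (ball 0 1 u)) => [bu|nb]; last by rewrite memNset// normr0 mulr0.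
rewrite mem_set// normr1 mulr1; apply: (le_trans (hM u)).
move: bu; rewrite -ball_normE/= sub0r normrN => /ltW u1.
by rewrite -[leRHS]mulr1 ler_wpM2l.
Qed.

Lemma truncated_bmfun (rho : dual X) : bmfun (truncated rho : borel X -> R).
Proof.
split.
  apply: measurable_funM; first exact: borel_dual.
  by apply: measurable_indic; apply: borel_open; exact: ball_open.
have /linear_bounded_continuous/linear_boundedP := @dual_continuous R X rho.
move=> /pinfty_ex_gt0[M M0 hM].
exists M; exact: truncated_le (ltW M0) hM.
Qed.

Lemma PsiE (rho : dual X) (u : X) :
  Psi rho u = ((cos (rho u) - 1) +i* (sin (rho u) - truncated rho u))%C.
Proof.
rewrite /Psi cexp_i /truncated; congr (_ +i* _)%C => /=; ring.
Qed.

Lemma cexpE (a b : R) : cexp (a +i* b)%C = ((expR a * cos b) +i* (expR a * sin b))%C.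
Proof. by rewrite /cexp /=; congr (_ +i* _)%C; ring. Qed.

End complex_bridge.

Section cylinder_bound.
Variables (R : realType) (X : completeNormedModType R).
Variables (mu gamma nu : probability (borel X) R) (m : X) (Q : dual X -> X).
Variables (k : R) (k0 : 0 <= k).
Hypothesis gammaG : centered_gaussian gamma.
Hypothesis gammaQ : forall rho : dual X,
  (rho (Q rho))%:E = covariance gamma (rho : borel X -> R) rho.
(** The characteristic function of mu, with jump measure k times nu. *)
Hypothesis muE : forall rho : dual X,
  let E := expR (- (2^-1 * rho (Q rho)) + k * (cf_cos nu (rho : borel X -> R) - 1)) in
  let t := rho m - k * (\int[nu]_u truncated rho u)
             + k * cf_sin nu (rho : borel X -> R) in
  cf_cos mu (rho : borel X -> R) = E * cos t /\
  cf_sin mu (rho : borel X -> R) = E * sin t.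

Section family.
Variables (I : finType) (rho : I -> dual X).
Hypothesis rho1 : forall i y, `|rho i y| <= `|y|.

Let e (x : borel X) : coords R I := fun i => rho i x.

Lemma measurable_cylinder : measurable_fun setT e.
Proof. by apply: measurable_coords => i; exact: borel_dual. Qed.

Let me := measurable_cylinder.

(** The point mass absorbs the compensator. *)
Let D : coords R I := fun i => rho i m - k * \int[nu]_u truncated (rho i) u.

Lemma supnorm_drift : supnorm D <= `|m| + k.
Proof.
apply: supnorm_le => [|i]; first by rewrite addr_ge0.
rewrite (le_trans (ler_normB _ _))// lerD// normrM ger0_norm// -[leRHS]mulr1 ler_wpM2l//.
apply: (le_trans (le_normr_Rintegral measurableT (bmfun_integrable nu (truncated_bmfun (rho i))))).
rewrite -[leRHS](Rintegral1 nu).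
apply: le_Rintegral => //.
- have := integrable_norm (bmfun_integrable nu (truncated_bmfun (rho i))); exact.
- exact: (bmfun_integrable nu (bmfun_cst _ 1)).
- by move=> u _; apply: truncated_le => // y; rewrite mul1r.
Qed.

Let lin_D c (sigma : dual X) : (forall x, sigma x = lin c (fun i => rho i x)) ->
  lin c D = sigma m - k * \int[nu]_u truncated sigma u.
Proof.
move=> sE; rewrite /lin; under eq_bigr do rewrite mulrBr mulrCA.
rewrite sumrB -/(lin _ _) -sE; congr (_ - _).
rewrite -mulr_sumr; congr (_ * _).
have -> : (truncated sigma : borel X -> R) =
    fun u => \sum_i c i * truncated (rho i) u.
  apply/funext => u; rewrite /truncated sE /lin mulr_suml.
  by apply: eq_bigr => i _; rewrite mulrA.
have bc i : bmfun (fun u : borel X => c i * truncated (rho i) u).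
  exact: bmfunM (bmfun_cst _ (c i)) (truncated_bmfun (rho i)).
rewrite [RHS]/Rintegral; under [in RHS]eq_integral do rewrite -sumEFin.
rewrite integral_sum//; last by move=> i; exact: (bmfun_integrable nu (bc i)).
rewrite -sum_fine; last first.
  by move=> i _; apply: integrable_fin_num => //; exact: (bmfun_integrable nu (bc i)).
apply: eq_bigr => i _; rewrite -RintegralZl//.
exact: (bmfun_integrable nu (truncated_bmfun (rho i))).
Qed.

Lemma gaussian_family_gamma : gaussian_family gamma (fun i => rho i : borel X -> R).
Proof.
split => [i|c]; first exact: borel_dual.
have [sigma sE] := dual_lin rho c; have [s hs] := gammaG.2 sigma.
exists s => A mA; rewrite -hs//; congr (gamma _).
by apply/seteqP; split => x /=; rewrite sE.
Qed.

Let G := law gamma me.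
Let N := law nu me.

(** The characteristic functions agree at c because lin c (rho_i x)_i is again a
    functional of x, to which the formula for mu applies. *)
Lemma law_infdiv (A : set (coords R I)) : measurable A ->
  law mu me A = infdiv D G N k0 A.
Proof.
move=> mA.
have cfE c : cf_cos (law mu me) (lin c) = cf_cos (infdiv D G N k0) (lin c) /\
             cf_sin (law mu me) (lin c) = cf_sin (infdiv D G N k0) (lin c).
  have [sigma sE] := dual_lin rho c.
  have lE : (fun x : borel X => lin c (e x)) = sigma by apply/funext => x; rewrite sE.
  have [v2 vc vs] := variance_linE gaussian_family_gamma c.
  have Gc : cf_cos G (lin c) = expR (- (2^-1 * sigma (Q sigma))).
    rewrite cf_cos_law vc; congr (expR (- (2^-1 * _))); apply: EFin_inj.
    have [s hs] := gammaG.2 sigma.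
    rewrite gammaQ (gaussian_covariance (borel_dual sigma) hs) -v2.
    by apply: eq_integral => x _; rewrite sE.
  have Gs : cf_sin G (lin c) = 0 by rewrite cf_sin_law.
  have [-> ->] := cf_infdiv D N k0 Gc Gs.
  rewrite !cf_cos_law !cf_sin_law lE (lin_D sE).
  exact: muE.
apply: (@charfun_unique R _ (law mu me) (infdiv D G N k0)) mA => c.
  exact: (cfE c).1.
exact: (cfE c).2.
Qed.

End family.

Variables (h : R -> R) (C J : R).
Hypotheses (h0 : forall t, 0 <= h t) (hnd : {homo h : s t / s <= t}).
Hypotheses (C0 : 0 < C) (hC : forall t s, h (t + s) <= C * h t * h s).
Hypothesis hJ : (\int[nu]_u (h `|(u : X)|)%:E <= J%:E)%E.

(** The three factors are bounded by h at |m| + k, by [fernique] for a ball of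
    gamma-measure at least 4/5, and by the moment J of the jumps. *)
Lemma cylinder_bound : exists M : R, forall (I : finType) (rho : I -> dual X),
  (forall i y, `|rho i y| <= `|y|) ->
  (\int[mu]_x (h (supnorm (fun i => rho i x)))%:E <= M%:E)%E.
Proof.
have [a a0 Pa] : exists2 a : R, 0 < a &
    ((4 / 5)%:E <= gamma [set x : borel X | `|(x : X)| <= a]%R)%E.
  have e0 : 0 < 1 / 5 :> R by lra.
  have [K [cK gK _]] := radon_tight gammaG.1 e0.
  have [a a0 ha] := pinfty_ex_gt0 (compact_bounded cK).
  exists a => //.
  have -> : 4 / 5 = 1 - 1 / 5 :> R by lra.
  apply: (le_trans gK); apply: le_measure => //.
  - by have mK : measurable (K : set (borel X)) := borel_compact cK; exact: mem_set mK.
  - by apply: mem_set; exact: measurable_sublevel (@borel_norm R X) _.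
have [M hM] := fernique h0 hnd C0 hC a0 gamma.
exists (C * (h (`|m| + k) * (C * (M * (h 0 * expR (k * (C * J) - k)))))) => I rho rho1.
have me := measurable_cylinder rho.
rewrite -(ge0_integral_law mu me (measurable_h_supnorm hnd)); last first.
  by move=> x; rewrite lee_fin.
rewrite (eq_measure_integral _ (fun A mA _ => law_infdiv rho mA)).
have sn x : supnorm (fun i => rho i x) <= `|x| by apply: supnorm_le.
have mN : measurable_fun setT (fun x : borel X => supnorm (fun i => rho i x)).
  by apply: (measurable_supnorm (f := fun i => rho i : borel X -> R)) => i; exact: borel_dual.
apply: integral_h_infdiv => //.
- exact: supnorm_drift.
- rewrite ge0_integral_law//; [|exact: measurable_h_supnorm|by move=> y; rewrite lee_fin].
  apply: hM; first exact: gaussian_family_gamma.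
  apply: le_trans Pa _; apply: le_measure.
  + by apply: mem_set; exact: measurable_sublevel (@borel_norm R X) _.
  + by apply: mem_set; exact: measurable_sublevel.
  + by move=> x /=; exact: le_trans.
- rewrite ge0_integral_law//; [|exact: measurable_h_supnorm|by move=> y; rewrite lee_fin].
  apply: le_trans hJ; apply: ge0_le_integral => //.
  + by move=> x _; rewrite lee_fin.
  + by apply/measurable_EFinP; exact: (measurableT_comp (measurable_h hnd) mN).
  + apply/measurable_EFinP; apply: (measurableT_comp (measurable_h hnd)).
    exact: borel_norm.
  + by move=> x _; rewrite lee_fin; apply: hnd.
Qed.

End cylinder_bound.

Section normalization.
Context d (T : measurableType d) (R : realType).
Variables (lambda : {measure set T -> \bar R}) (k : R).
Hypothesis k0 : 0 < k.

Let kV0 : 0 <= k^-1. Proof. by rewrite invr_ge0 ltW. Qed.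

(** The equation on the total mass is an argument of the definition so that the
    probability structure is found by inference. *)
Definition normalized (_ : lambda setT = k%:E) : set T -> \bar R :=
  mscale (NngNum kV0) lambda.

Hypothesis lambdaT : lambda setT = k%:E.
Local Notation nlambda := (normalized lambdaT).

HB.instance Definition _ := Measure.on nlambda.

Let normalized_setT : nlambda setT = 1%E.
Proof. by rewrite /normalized /mscale /= lambdaT -EFinM mulVf// gt_eqF. Qed.

HB.instance Definition _ :=
  Measure_isProbability.Build _ _ _ nlambda normalized_setT.

Lemma ge0_integral_normalized (f : T -> \bar R) : measurable_fun setT f ->
  (forall x, 0 <= f x)%E -> (\int[lambda]_x f x = k%:E * \int[nlambda]_x f x)%E.
Proof.
move=> mf f0; rewrite ge0_integral_mscale//= muleA -EFinM divff ?gt_eqF//.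
by rewrite mul1e.
Qed.

Lemma Rintegral_normalized (f : T -> R) : bmfun f ->
  \int[lambda]_x f x = k * \int[nlambda]_x f x.
Proof.
move=> bf.
have intf := bmfun_integrable nlambda bf.
have mf : measurable_fun setT (EFin \o f) by case/integrableP : intf.
have fi := integrable_fin_num measurableT intf.
rewrite /Rintegral -[k in RHS]/(fine k%:E) -fineM//; congr fine.
rewrite (integralE lambda) (integralE nlambda).
have -> := ge0_integral_normalized (measurable_funepos mf) (@funepos_ge0 _ _ _).
have -> := ge0_integral_normalized (measurable_funeneg mf) (@funeneg_ge0 _ _ _).
have fn := integrable_neg_fin_num measurableT intf.
apply/esym; apply: muleBr => //; apply: fin_num_adde_defl; rewrite fin_numN.
exact: fn.
Qed.

End normalization.

(** On a compact set K that is normed up to 1 by a finite family,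
    h |x| <= h (max + 1) <= C h 1 h (max); off K the truncation of h at n
    contributes at most n mu (~ K) <= 1. *)
Lemma integrable_of_cylinder_bound (R : realType) (X : completeNormedModType R)
    (mu : probability (borel X) R) (h : R -> R) (C M : R) :
  radon mu ->
  (forall t, 0 <= h t) -> {homo h : s t / s <= t} -> 0 < C ->
  (forall t s, h (t + s) <= C * h t * h s) ->
  (forall (I : finType) (rho : I -> dual X), (forall i y, `|rho i y| <= `|y|) ->
    (\int[mu]_x (h (supnorm (fun i => rho i x)))%:E <= M%:E)%E) ->
  mu.-integrable setT (fun u : borel X => (h `|(u : X)|)%:E).
Proof.
move=> rmu h0 hnd C0 hC hM.
have mh : measurable_fun setT (fun u : borel X => h `|(u : X)|).
  exact: (measurableT_comp (measurable_h hnd) (@borel_norm R X)).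
pose g n (x : borel X) : \bar R := (Num.min (h `|(x : X)|) n%:R)%:E.
have mg n : measurable_fun setT (g n).
  by apply/measurable_EFinP; apply: measurable_minr.
have g0 n x : setT x -> (0 <= g n x)%E by move=> _; rewrite lee_fin le_min h0 ler0n.
have gle n : (\int[mu]_x g n x <= (C * h 1 * M + 1)%:E)%E.
  have [|K [cK _ Ke]] := radon_tight rmu (_ : 0 < n.+1%:R^-1 :> R); first by rewrite invr_gt0.
  have [I [rho [rho1 Krho]]] := compact_norming cK.
  have mK : measurable (K : set (borel X)) := borel_compact cK.
  have ms : measurable_fun setT (fun x : borel X => h (supnorm (fun i => rho i x))).
    apply: (measurableT_comp (measurable_h hnd)).
    by apply: (measurable_supnorm (f := fun i => rho i : borel X -> R)) => i; exact: borel_dual.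
  pose f1 (x : borel X) : R := C * h 1 * h (supnorm (fun i => rho i x)).
  pose f2 (x : borel X) : R := n%:R * \1_(~` K : set (borel X)) x.
  have mf1 : measurable_fun setT f1 by exact: measurable_funM.
  have mf2 : measurable_fun setT f2.
    by apply: measurable_funM => //; apply: measurable_indic; exact: measurableC.
  have f10 x : 0 <= f1 x by rewrite !mulr_ge0// ltW.
  have f20 x : 0 <= f2 x by rewrite mulr_ge0.
  apply: (@le_trans _ _ (\int[mu]_x ((f1 x)%:E + (f2 x)%:E))%E).
    apply: ge0_le_integral => //.
    - exact: g0.
    - by apply: emeasurable_funD; apply/measurable_EFinP.
    - move=> x _; rewrite /f1 /f2 -EFinD lee_fin indicE.
      case: (asboolP (K x)) => [Kx|nKx].
        rewrite memNset ?mulr0 ?addr0; last by move=> /(_ Kx).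
        rewrite ge_min; apply/orP; left.
        apply: (le_trans (hnd _ _ (Krho _ Kx))); apply: (le_trans (hC _ _)).
        by rewrite mulrAC.
      rewrite mem_set// mulr1 ge_min; apply/orP; right.
      by rewrite lerDr !mulr_ge0// ltW.
  rewrite ge0_integralD//; try (by move=> x _; rewrite lee_fin); try exact/measurable_EFinP.
  rewrite EFinD; apply: leeD.
    rewrite /f1; under eq_integral do rewrite EFinM.
    rewrite ge0_integralZl_EFin//; last 3 first.
    - by move=> x _; rewrite lee_fin.
    - exact/measurable_EFinP.
    - by rewrite mulr_ge0// ltW.
    rewrite [leRHS]EFinM lee_wpmul2l//; first by rewrite lee_fin mulr_ge0// ltW.
    exact: hM.
  rewrite /f2; under eq_integral do rewrite EFinM.
  rewrite ge0_integralZl_EFin//; last first.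
    by apply/measurable_EFinP; apply: measurable_indic; exact: measurableC.
  rewrite integral_indic//; last exact: measurableC.
  rewrite setIT.
  apply: (@le_trans _ _ (n%:R%:E * (n.+1%:R^-1)%:E)%E); first by rewrite lee_wpmul2l// lee_fin.
  by rewrite -EFinM lee_fin ler_pdivrMr// mul1r ler_nat.
have gnd x : setT x -> nondecreasing_seq (g ^~ x).
  move=> _ a b ab; rewrite lee_fin le_min !ge_min lexx/=.
  by rewrite ler_nat ab orbT.
have := cvg_monotone_convergence measurableT mg g0 gnd.
have -> : (fun x => limn (g ^~ x)) = (fun u : borel X => (h `|(u : X)|)%:E).
  apply/funext => x; apply/cvg_lim => //; apply: cvg_near_cst; near=> n.
  congr EFin; apply/min_idPl.
  by near: n; exact: nbhs_infty_ger.
move=> /(_ mu) gcvg.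
apply/integrableP; split; first exact/measurable_EFinP.
under eq_integral do rewrite /= ger0_norm//.
apply: (@le_lt_trans _ _ (C * h 1 * M + 1)%:E); last exact: ltry.
have <- := cvg_lim _ gcvg => //.
apply: lime_le; first by apply/cvg_ex; eexists; exact: gcvg.
by near=> n; exact: gle.
Unshelve. all: by end_near. Qed.

Theorem theorem2p15 (R : realType) (X : completeNormedModType R)
    (lambda : {measure set (borel X) -> \bar R})
    (mu : probability (borel X) R) (m : X) (Q : dual X -> X)
    (Hlambda : levy_measure lambda)
    (Hlambda_gt0 : (0 < lambda setT)%E)
    (Hlambda_fin : (lambda setT < +oo)%E)
    (Hmu : is_ID mu m Q lambda)
    (Hmu1 : mu setT = 1%E)
    (Hnorm : {ae mu, forall u : borel X, ((`|(u : X)|)%:E < +oo)%E})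
    (h : R -> R) (Hh : submultiplicative h) :
  lambda.-integrable setT (fun u : borel X => (h `|(u : X)|)%:E) ->
  mu.-integrable setT (fun u : borel X => (h `|(u : X)|)%:E).
Proof.
move=> hlambda; have [h0 hnd _ [C [C0 hC]]] := Hh.
have [[rmu _] [gamma [gammaG gammaQ]] _ muE] := Hmu.
pose k := fine (lambda setT).
have lambdaT : lambda setT = k%:E by rewrite fineK// ge0_fin_numE.
have k0 : 0 < k by rewrite -lte_fin -lambdaT.
pose nu : probability (borel X) R := normalized k0 lambdaT.
have [|||M hM] := @cylinder_bound R X mu gamma nu m Q k (ltW k0) gammaG _ _ h C
   (fine (\int[nu]_u (h `|(u : X)|)%:E)) h0 hnd C0 hC.
- by move=> rho; exact: gammaQ.
- move=> rho E t.
  have br := @borel_dual R X rho.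
  have := muE rho; rewrite charfunE => muR.
  have : cexp ('i%C * ((rho m)%:C)%C - ((2^-1 * rho (Q rho))%:C)%C + cintegral lambda (Psi rho)) =
     ((E * cos t) +i* (E * sin t))%C.
    rewrite -cexpE; congr cexp.
    have bc := bmfun_cos br; have bs := bmfun_sin br; have bt := truncated_bmfun rho.
    have b1 : bmfun (fun _ : borel X => 1 : R) := bmfun_cst _ 1.
    have -> : cintegral lambda (Psi rho) = ((k * (cf_cos nu (rho : borel X -> R) - 1)) +i*
        (k * (cf_sin nu (rho : borel X -> R) - \int[nu]_u truncated rho u)))%C.
      rewrite /cintegral; congr (_ +i* _)%C.
      - under eq_Rintegral do rewrite PsiE /=.
        rewrite (Rintegral_normalized k0 lambdaT); last exact: bmfunB.
        by rewrite RintegralB ?Rintegral1//; exact: bmfun_integrable.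
      - under eq_Rintegral do rewrite PsiE /=.
        rewrite (Rintegral_normalized k0 lambdaT); last exact: bmfunB.
        by rewrite RintegralB//; exact: bmfun_integrable.
    by rewrite /t; congr (_ +i* _)%C => /=; ring.
  rewrite -muR => -[-> ->]; by [].
- rewrite fineK//.
  have mh : measurable_fun setT (fun u : borel X => (h `|(u : X)|)%:E).
    by case/integrableP : hlambda.
  have hN0 (u : borel X) : (0 <= (h `|(u : X)|)%:E)%E by rewrite lee_fin.
  rewrite ge0_fin_numE; last by apply: integral_ge0 => u _; exact: hN0.
  rewrite ltey; apply/eqP => nuoo.
  have := integrable_fin_num measurableT hlambda.
  by rewrite (ge0_integral_normalized k0 lambdaT mh hN0) nuoo gt0_muley ?lte_fin.
exact: integrable_of_cylinder_bound rmu h0 hnd C0 hC hM.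
Qed.
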